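(* Let $m_1,m_2,m_3,m_4\ge1$ be integers and let $G$ be the complete $4$-partite graph with $V(G) = \bigsqcup_{i=1}^4 V_i$ and $E(G) = \{\{a,b\} : a \in V_i,\ b \in V_j,\ i \neq j \}$, where $V_i = \{x_{i1}, \ldots, x_{im_i}\}$ for $i = 1, \ldots, 4$. Let $K$ be a field and let $J_G \subset R = K[x_{ij} : 1 \leq i \leq 4,\ 1\leq j \leq m_i]$ (with the standard grading) denote the cover ideal of $G$. Let $s\ge 1$. Then the minimal free resolution of $R/J_G^s$ is of the form \[ 0 \to R^{\binom{s}{3}} \longrightarrow R^{3\binom{s+1}{3}} \longrightarrow R^{3\binom{s+2}{3}} \longrightarrow R^{\binom{s+3}{3}} \longrightarrow R \to 0. \] For integers $\ell_1,\ldots,\ell_4$ set $\alpha = (s-\ell_4)m_1 +(s-\ell_3)m_2+ (s-\ell_2)m_3 + (s-\ell_1)m_4$. Furthermore, \[ \operatorname{reg}(J_G^s) = \max \left\{ \begin{array}{ll} \alpha, & \text{ for } 0 \leq \ell_1, \ell_2, \ell_3, \ell_4 \leq s, \\ \alpha + m_4-1, & \text{ for } 1 \leq \ell_1 \leq s, \; 0 \leq \ell_2, \ell_3, \ell_4 \leq s-1, \\ \alpha + 2m_4-2, & \text{ for } 2 \leq \ell_1 \leq s, \; 0 \leq \ell_2, \ell_3, \ell_4 \leq s-2, \\ \alpha + 3m_4-3, & \text{ for } 3 \leq \ell_1 \leq s, \; 0 \leq \ell_2, \ell_3, \ell_4 \leq s-3 \end{array} \right\}, \] the maximum being over all the listed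 numbers, where in each line $(\ell_1,\ell_2,\ell_3,\ell_4)$ ranges over the integer tuples in the indicated range satisfying $\ell_1 + \ell_2 +\ell_3 +\ell_4 =s$.
   Context: A vertex cover of $G$ is a set $w$ of vertices meeting every edge. The cover ideal $J_G$ is the ideal generated by the squarefree monomials $\prod_{v\in w}v$ with $w$ a vertex cover of $G$ (vertices identified with variables); equivalently $J_G=\bigcap_{\{u,v\}\in E(G)}(u,v)$. For a finitely generated graded $R$-module $M$, $\operatorname{reg}(M)=\max\{j-i : \operatorname{Tor}_i^R(M,K)_j\neq 0\}$ is the Castelnuovo-Mumford regularity. Conventions: $\binom{a}{b}=0$ if $0\le a<b$, and an empty range contributes nothing to the maximum. *)

(* Defs.v *)
From HB Require Import structures.
From mathcomp Require Import all_boot all_order all_algebra.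
From mathcomp Require Export mpoly.
Set Implicit Arguments.
Unset Strict Implicit.
Unset Printing Implicit Defensive.
Import Order.TTheory GRing.Theory Num.Theory.
Local Open Scope ring_scope.

Definition is_max (A : int -> Prop) (r : int) : Prop :=
  A r /\ forall z, A z -> z <= r.

Definition ideal_gen (R : comNzRingType) (S : R -> Prop) (x : R) : Prop :=
  exists (n : nat) (c g : 'I_n -> R),
    (forall i, S (g i)) /\ x = \sum_(i < n) c i * g i.

Definition ideal_exp (R : comNzRingType) (I : R -> Prop) (s : nat) : R -> Prop :=
  ideal_gen (fun x : R => exists f : 'I_s -> R,
    (forall i, I (f i)) /\ x = \prod_(i < s) f i).

Definition ideal0 (R : comNzRingType) (x : R) : Prop := x = 0.

Definition ideal1 (R : comNzRingType) (x : R) : Prop := True.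

Definition vertex_cover (V : finType) (e : rel V) (w : {set V}) : bool :=
  [forall a, forall b, e a b ==> ((a \in w) || (b \in w))].

(* The variable of the vertex v is 'X_(enum_rank v). *)
Definition cover_ideal (K : fieldType) (V : finType) (e : rel V) :
    {mpoly K[#|V|]} -> Prop :=
  ideal_gen (fun p : {mpoly K[#|V|]} => exists w : {set V},
    vertex_cover e w /\ p = \prod_(v in w) 'X_(enum_rank v)).

Arguments cover_ideal K [V] e.

Definition multipartite_vertex (k : nat) (m : 'I_k -> nat) : finType :=
  {i : 'I_k & 'I_(m i)}.

Definition multipartite_edge (k : nat) (m : 'I_k -> nat) :
    rel (multipartite_vertex m) :=
  fun a b => tag a != tag b.

Definition part_size4 (m1 m2 m3 m4 : nat) : 'I_4 -> nat :=
  fun i => nth 0%N [:: m1; m2; m3; m4] i.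

Definition homog_of_degree (K : fieldType) (n : nat) (d : int)
    (p : {mpoly K[n]}) : Prop :=
  match d with
  | Posz k => p \is k.-homog
  | Negz _ => p = 0
  end.

(* With R = K[X_0, ..., X_(n-1)]: F_i = (+)_(k < rk i) R(- gdeg k) consists of
   row vectors; the differential F_(i+1) -> F_i is v |-> v *m diff i, and the
   augmentation, from F_0 to a subquotient of R, is induced by v |-> v *m aug. *)
Record graded_free_complex (K : fieldType) (n : nat) := GradedFreeComplex {
  rk : nat -> nat;
  gdeg : forall i, 'I_(rk i) -> int;
  diff : forall i, 'M[{mpoly K[n]}]_(rk i.+1, rk i);
  aug : 'cV[{mpoly K[n]}]_(rk 0%N);
  diff_homog : forall i k l,
    homog_of_degree (gdeg k - gdeg l) (diff i k l);
  aug_homog : forall k l, homog_of_degree (gdeg k) (aug k l)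
}.

(* F is a graded free resolution of the graded module A / B, for homogeneous
   ideals B <= A of R: the ideal I is A / B with A = I, B = 0, and R / I is
   A / B with A = R, B = I. *)
Definition is_resolution (K : fieldType) (n : nat)
    (F : graded_free_complex K n) (A B : {mpoly K[n]} -> Prop) : Prop :=
  [/\ forall k, A (aug F k 0),
      forall a, A a -> exists v : 'rV_(rk F 0), B (a - (v *m aug F) 0 0),
      forall v : 'rV_(rk F 0),
        B ((v *m aug F) 0 0) <-> exists w, v = w *m diff F 0
    & forall i (v : 'rV_(rk F i.+1)),
        v *m diff F i = 0 <-> exists w, v = w *m diff F i.+1].

(* The differential of F (x)_R K: R -> R / (X_0, ..., X_(n-1)) = K takes the
   constant coefficient. *)
Definition diffK (K : fieldType) (n : nat) (F : graded_free_complex K n)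
    (i : nat) : 'M[K]_(rk F i.+1, rk F i) :=
  map_mx (mcoeff 0%MM) (diff F i).

(* diff maps F_(i+1) into (X_0, ..., X_(n-1)) F_i *)
Definition is_minimal (K : fieldType) (n : nat)
    (F : graded_free_complex K n) : Prop :=
  forall i, diffK F i = 0.

Definition is_minimal_resolution (K : fieldType) (n : nat)
    (F : graded_free_complex K n) (A B : {mpoly K[n]} -> Prop) : Prop :=
  is_resolution F A B /\ is_minimal F.

Definition cycleK (K : fieldType) (n : nat) (F : graded_free_complex K n)
    (i : nat) : 'rV[K]_(rk F i) -> Prop :=
  match i with
  | 0%N => fun _ => True
  | i'.+1 => fun v => v *m diffK F i' = 0
  end.

(* H_i(F (x)_R K)_j <> 0.  Since diffK has degree 0, an element of degree j is
   a boundary iff it is the boundary of an element of degree j, hence no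
   condition on w. *)
Definition homologyK_neq0 (K : fieldType) (n : nat)
    (F : graded_free_complex K n) (i : nat) (j : int) : Prop :=
  exists v : 'rV[K]_(rk F i),
    [/\ forall k, v 0 k != 0 -> gdeg k = j,
        cycleK v
      & ~ exists w : 'rV[K]_(rk F i.+1), v = w *m diffK F i].

(* Tor_i^R(A / B, K)_j <> 0; this does not depend on the choice of F. *)
Definition Tor_neq0 (K : fieldType) (n : nat) (A B : {mpoly K[n]} -> Prop)
    (i : nat) (j : int) : Prop :=
  exists F : graded_free_complex K n,
    is_resolution F A B /\ homologyK_neq0 F i j.

Definition is_reg (K : fieldType) (n : nat) (A B : {mpoly K[n]} -> Prop)
    (r : int) : Prop :=
  is_max (fun z => exists (i : nat) (j : int),
    Tor_neq0 A B i j /\ z = j - i%:Z) r.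

Definition cover4_rank (s i : nat) : nat :=
  match i with
  | 0 => 1
  | 1 => 'C(s + 3, 3)
  | 2 => 3 * 'C(s + 2, 3)
  | 3 => 3 * 'C(s + 1, 3)
  | 4 => 'C(s, 3)
  | _ => 0
  end%N.

Definition cover4_reg_candidate (s m1 m2 m3 m4 : int) (z : int) : Prop :=
  exists l1 l2 l3 l4 : int,
    l1 + l2 + l3 + l4 = s /\
    let alpha :=
      (s - l4) * m1 + (s - l3) * m2 + (s - l2) * m3 + (s - l1) * m4 in
    [\/ [/\ 0 <= l1 <= s, 0 <= l2 <= s, 0 <= l3 <= s & 0 <= l4 <= s] /\
        z = alpha,
        [/\ 1 <= l1 <= s, 0 <= l2 <= s - 1, 0 <= l3 <= s - 1
          & 0 <= l4 <= s - 1] /\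
        z = alpha + m4 - 1,
        [/\ 2 <= l1 <= s, 0 <= l2 <= s - 2, 0 <= l3 <= s - 2
          & 0 <= l4 <= s - 2] /\
        z = alpha + 2 * m4 - 2
      | [/\ 3 <= l1 <= s, 0 <= l2 <= s - 3, 0 <= l3 <= s - 3
          & 0 <= l4 <= s - 3] /\
        z = alpha + 3 * m4 - 3].

(* Main.v *)
(** With [T_i] the product of the variables in [V_i], the ideal [J^s] is generated
    by the monomials [T_1^(s-a_1) ... T_4^(s-a_4)], [a_1 + ... + a_4 = s].  The Rees
    algebra of [J] is the complete intersection
    [R[w_1..w_4] / (T_i w_i - T_4 w_4, i = 1, 2, 3)], so the degree [s] strand of the
    Koszul complex on these three elements resolves [J^s]; it is minimal, and the
    ranks and the regularity can be read off its generators.  Setting [w_4 = 1]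
    replaces degree [d] in [w] by degree at most [d] in [w_1, w_2, w_3].

    Exactness is obtained from division with remainder by [T_i w_i - T_4] with leading
    term [T_i w_i]: the leading terms being pairwise coprime, division by one of the
    three elements commutes with multiplication by the others, and a remainder for all
    three that vanishes under [w_i := T_4 / T_i] is zero.  That the ranks and the
    [Tor] degrees do not depend on the resolution is the usual comparison of
    resolutions by chain maps, unique up to homotopy. *)
From HB Require Import structures.
From Stdlib Require Import ClassicalEpsilon.
Require Import Defs.
From mathcomp Require Import all_boot all_order all_algebra.
From mathcomp Require Import zify ring.
Set Implicit Arguments.
Unset Strict Implicit.
Unset Printing Implicit Defensive.
Import Order.TTheory GRing.Theory Num.Theory.
Local Open Scope ring_scope.

(** * Choice along sequences and lifting through matrices *)

(** The types depend on the index because the ranks of a complex do; [Q] is the invariant that makes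
    the next choice possible. *)
Lemma dependent_choice (T : nat -> Type) (Q : forall i, T i -> Prop)
    (R : forall i, T i -> T i.+1 -> Prop) :
  (exists x, Q 0%N x) ->
  (forall i x, Q i x -> exists y, R i x y /\ Q i.+1 y) ->
  exists f : forall i, T i,
    (forall i, Q i (f i)) /\ (forall i, R i (f i) (f i.+1)).
Proof.
move=> /constructive_indefinite_description x0 step.
pose next i (x : {x | Q i x}) :=
  constructive_indefinite_description _ (step i _ (proj2_sig x)).
pose f := fix f i : {x | Q i x} :=
  if i is j.+1 then exist _ _ (proj2 (proj2_sig (next j (f j)))) else x0.
exists (fun i => proj1_sig (f i)); split=> i; first exact: proj2_sig.
exact: proj1 (proj2_sig (next i (f i))).
Qed.

(** Free modules are projective: it suffices to lift the images of the basis vectors, one row at a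
    time. *)
Lemma mulmx_lift (R : pzSemiRingType) (a b c : nat) (M : 'M[R]_(a, c))
    (D : 'M[R]_(b, c)) :
  (forall v : 'rV_a, exists w, v *m M = w *m D) -> exists N, N *m D = M.
Proof.
move=> liftM; have /fin_all_exists [f fE] (i : 'I_a) : exists w, row i M = w *m D.
  by have [w vM] := liftM (delta_mx 0 i); exists w; rewrite rowE.
by exists (\matrix_i f i); apply/row_matrixP => i; rewrite row_mul rowK fE.
Qed.

(** * Ideals as predicates, generated ideals and products *)

Section Ideals.
Variable R : comNzRingType.
Implicit Types (B P S : R -> Prop).

Definition is_ideal B :=
  [/\ B 0, forall x y, B x -> B y -> B (x - y) & forall c x, B x -> B (c * x)].

Lemma is_idealD B x y : is_ideal B -> B x -> B y -> B (x + y).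
Proof.
move=> [B0 BB _] Bx By; rewrite -[y]opprK -[- y]sub0r; apply: (BB) => //.
exact: (BB).
Qed.

Lemma is_ideal_sum B (I : Type) (r : seq I) (P : pred I) (f : I -> R) :
  is_ideal B -> (forall i, P i -> B (f i)) -> B (\sum_(i <- r | P i) f i).
Proof.
move=> Bid Bf; apply: (big_ind B) => // [|x y]; last exact: is_idealD.
by case: Bid.
Qed.

Lemma is_ideal0 : is_ideal (@ideal0 R).
Proof.
by rewrite /ideal0; split=> // [x y -> ->|c x ->]; rewrite ?subrr ?mulr0.
Qed.

(** This colon ideal reduces a statement about products to one about generators, one factor at a
    time. *)
Lemma is_ideal_quo B y : is_ideal B -> is_ideal (fun x => B (x * y)).
Proof.
move=> [B0 BB BM]; split=> [|x z Bx Bz|c x Bx]; first by rewrite mul0r.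
  by rewrite mulrBl; exact: BB.
by rewrite -mulrA; exact: BM.
Qed.

Lemma ideal_gen_mem S x : S x -> ideal_gen S x.
Proof. by move=> Sx; exists 1%N, (fun=> 1), (fun=> x); rewrite big_ord1 mul1r. Qed.

Lemma ideal_gen_ind S P : is_ideal P -> (forall x, S x -> P x) ->
  forall x, ideal_gen S x -> P x.
Proof.
move=> Pid SP _ [k [c [g [Sg ->]]]]; apply: is_ideal_sum => // i _.
by have [_ _ PM] := Pid; apply/PM/SP.
Qed.

Lemma ideal_gen_ideal S : is_ideal (ideal_gen S).
Proof.
have gM c x : ideal_gen S x -> ideal_gen S (c * x).
  move=> [k [a [g [Sg ->]]]]; exists k, (fun i => c * a i), g; split=> //.
  by rewrite mulr_sumr; apply: eq_bigr => i _; rewrite mulrA.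
split=> // [|x y [k [a [g [Sg ->]]]] /(gM (-1)) [l [b [h [Sh]]]]].
  by exists 0%N, (fun=> 0), (fun=> 0); rewrite big_ord0; split=> // -[].
(* A difference of two combinations is one combination over the concatenated index range; [pick]
   glues the two families. *)
rewrite mulN1r => ->; pose pick f1 f2 (i : 'I_(k + l)) : R :=
  match split i with inl j => f1 j | inr j => f2 j end.
have pickl f1 f2 i : pick f1 f2 (lshift l i) = f1 i by rewrite /pick (unsplitK (inl i)).
have pickr f1 f2 i : pick f1 f2 (rshift k i) = f2 i by rewrite /pick (unsplitK (inr i)).
exists (k + l)%N, (pick a b), (pick g h); split=> [i|].
  by rewrite /pick; case: split.
rewrite big_split_ord; congr (_ + _); apply: eq_bigr => i _; rewrite ?pickl ?pickr //.
Qed.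

Lemma ideal_exp_prodS (J : R -> Prop) s x y :
  (exists f : 'I_s -> R, (forall i, J (f i)) /\ x = \prod_i f i) -> J y ->
  exists f : 'I_s.+1 -> R, (forall i, J (f i)) /\ x * y = \prod_i f i.
Proof.
move=> [f [Jf ->]] Jy; exists (fun i => if unlift ord_max i is Some j then f j else y).
split=> [i|]; first by case: unlift.
rewrite big_ord_recr unlift_none /=; congr (_ * _); apply: eq_bigr => i _.
by rewrite (_ : widen_ord _ i = lift ord_max i) ?liftK //; apply: val_inj; rewrite [RHS]lift_max.
Qed.
End Ideals.

(** * Comparison of graded resolutions *)

Section Homogeneous.
Variables (K : fieldType) (n : nat).
Local Notation R := {mpoly K[n]}.

Definition homog_part (d : int) (p : R) : R :=
  if d is Posz k then pihomog mdeg k p else 0.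

Lemma mcoeff_homog_part d p m :
  (homog_part d p)@_m = if (mdeg m)%:Z == d then p@_m else 0.
Proof.
case: d => [d|d] /=; last by rewrite mcoeff0.
rewrite eqz_nat pihomogE raddf_sum /= big_mkcond /=.
case: eqVneq => [md|md].
  rewrite [in RHS](mpolyE p) raddf_sum /=; apply: eq_bigr => k _.
  case: eqVneq => // kd; rewrite mcoeffZ mcoeffX.
  by case: eqVneq => [km|_]; [rewrite -md km eqxx in kd|rewrite mulr0].
apply: big1 => k _; case: eqVneq => // kd; rewrite mcoeffZ mcoeffX.
by case: eqVneq => [km|_]; [rewrite -km kd eqxx in md|rewrite mulr0].
Qed.

Lemma homog_of_degreeP d (p : R) :
  homog_of_degree d p <-> forall m, p@_m != 0 -> (mdeg m)%:Z = d.
Proof.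
case: d => [d|d] /=.
  split=> [/dhomogP hp m pm|hp]; first by rewrite hp // mcoeff_msupp.
  by apply/dhomogP => m; rewrite mcoeff_msupp => /hp [].
split=> [-> m|hp]; first by rewrite mcoeff0 eqxx.
by apply/mpolyP => m; rewrite mcoeff0; apply/eqP; apply: contraT => /hp.
Qed.

Lemma homog_part_id d (p : R) : homog_of_degree d p -> homog_part d p = p.
Proof.
move=> /homog_of_degreeP hp; apply/mpolyP => m; rewrite mcoeff_homog_part.
by case: eqP => // md; case: (eqVneq p@_m 0) => // /hp.
Qed.

Lemma homog_part_homog d (p : R) : homog_of_degree d (homog_part d p).
Proof.
apply/homog_of_degreeP => m; rewrite mcoeff_homog_part.
by case: ifP => [/eqP //|_]; rewrite eqxx.
Qed.

Lemma homog_part0 d : homog_part d 0 = 0.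
Proof. by apply/mpolyP => m; rewrite mcoeff_homog_part mcoeff0 if_same. Qed.

Lemma homog_part_sum d (I : Type) (r : seq I) (P : pred I) (F : I -> R) :
  homog_part d (\sum_(i <- r | P i) F i) =
  \sum_(i <- r | P i) homog_part d (F i).
Proof.
apply: (big_morph _ _ (homog_part0 d)) => p q.
by apply/mpolyP => m; rewrite mcoeffD !mcoeff_homog_part mcoeffD; case: eqP;
   rewrite ?addr0.
Qed.

(** Multiplication by the homogeneous [q] shifts all degrees by [e]. Hence the graded part of an
    ungraded lift through a homogeneous matrix is again a lift. *)
Lemma homog_partM (d e : int) (p q : R) :
  homog_of_degree e q -> homog_part (d + e) (p * q) = homog_part d p * q.
Proof.
move=> /homog_of_degreeP hq; apply/mpolyP => m; rewrite mcoeff_homog_part.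
have degE (k1 k2 : 'X_{1..n}) : m == (k1 + k2)%MM -> q@_k2 != 0 ->
    ((mdeg m)%:Z == d + e) = ((mdeg k1)%:Z == d).
  by move=> /eqP -> /hq <-; rewrite mdegD PoszD (inj_eq (addIr _)).
rewrite !mcoeffM.
have -> (b : bool) (x : K) : (if b then x else 0) = x *+ b by case: b.
rewrite -sumrMnl; apply: eq_bigr => k /degE mk.
rewrite mcoeff_homog_part; case: (eqVneq q@_k.2 0) => [->|/mk ->].
  by rewrite !mulr0 mul0rn.
by case: ifP; rewrite ?mul0r.
Qed.

Definition homog_mx a b (g : 'I_a -> int) (h : 'I_b -> int) (M : 'M[R]_(a, b)) :=
  forall i j, homog_of_degree (g i - h j) (M i j).

Definition homog_part_mx a b (g : 'I_a -> int) (h : 'I_b -> int)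
    (M : 'M[R]_(a, b)) : 'M[R]_(a, b) :=
  \matrix_(i, j) homog_part (g i - h j) (M i j).

Lemma homog_part_mx_homog a b (g : 'I_a -> int) (h : 'I_b -> int) M :
  homog_mx g h (homog_part_mx g h M).
Proof. by move=> i j; rewrite mxE; exact: homog_part_homog. Qed.

Lemma homog_part_mx_id a b (g : 'I_a -> int) (h : 'I_b -> int) M :
  homog_mx g h M -> homog_part_mx g h M = M.
Proof. by move=> hM; apply/matrixP => i j; rewrite mxE homog_part_id. Qed.

Lemma homog_part_mxM a b c (g : 'I_a -> int) (h : 'I_b -> int) (k : 'I_c -> int)
    (M : 'M[R]_(a, b)) N : homog_mx h k N ->
  homog_part_mx g k (M *m N) = homog_part_mx g h M *m N.
Proof.
move=> hN; apply/matrixP => i j; rewrite !mxE homog_part_sum.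
apply: eq_bigr => l _; rewrite !mxE -(homog_partM _ _ (hN l j)).
by congr (homog_part _ _); ring.
Qed.

Lemma homog_mxM a b c (g : 'I_a -> int) (h : 'I_b -> int) (k : 'I_c -> int)
    (M : 'M[R]_(a, b)) (N : 'M[R]_(b, c)) :
  homog_mx g h M -> homog_mx h k N -> homog_mx g k (M *m N).
Proof.
move=> hM hN; rewrite -(homog_part_mx_id hM) -(homog_part_mxM _ _ hN).
exact: homog_part_mx_homog.
Qed.

End Homogeneous.

(** * Chain maps, homotopies and homology over the residue field *)

Section Comparison.
Variables (K : fieldType) (n : nat).
Local Notation R := {mpoly K[n]}.
Implicit Types (F G : graded_free_complex K n) (A B : R -> Prop).

Definition chain_map F G (phi : forall i, 'M[R]_(rk F i, rk G i)) :=
  forall i, phi i.+1 *m diff G i = diff F i *m phi i.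

(** The augmentations land in [A / B], so a lift of the identity respects them only modulo [B]. *)
Definition lifts_id B F G (phi : 'M[R]_(rk F 0, rk G 0)) :=
  forall v : 'rV_(rk F 0), B ((v *m phi *m aug G - v *m aug F) 0 0).

Lemma resolution_diff_aug A B F (v : 'rV_(rk F 1)) : is_resolution F A B ->
  B ((v *m diff F 0 *m aug F) 0 0).
Proof. by move=> [_ _ F0 _]; apply/F0; exists v. Qed.

Lemma resolution_diff_diff A B F i : is_resolution F A B ->
  diff F i.+1 *m diff F i = 0.
Proof.
move=> [_ _ _ FS]; apply/row_matrixP => k; rewrite row_mul row0.
by apply/FS; exists (delta_mx 0 k); rewrite rowE.
Qed.

(** The comparison theorem, by lifting degree after degree. The property [P] is carried along so
    that each lift can be corrected; it is instantiated by homogeneity or by [True]. *)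
Lemma chain_map_exists A B F G (P : forall i, 'M[R]_(rk F i, rk G i) -> Prop) :
    is_ideal B -> is_resolution F A B -> is_resolution G A B ->
    (exists2 phi, P 0%N phi & lifts_id B phi) ->
    (forall i phi N, P i phi -> N *m diff G i = diff F i *m phi ->
       exists2 N', P i.+1 N' & N' *m diff G i = diff F i *m phi) ->
  exists phi, [/\ chain_map phi, lifts_id B (phi 0%N) & forall i, P i (phi i)].
Proof.
move=> [B0 BB BM] resF resG [phi0 Pphi0 phi0B] step.
have [_ _ G0 GS] := resG.
(* In positive degree the invariant says that [diff F j.+1] followed by [phi] lands in the cycles of
   [G], so that exactness provides the next lift. *)
pose Q i : 'M[R]_(rk F i, rk G i) -> Prop :=
  if i is j.+1 return 'M[R]_(rk F i, rk G i) -> Prop then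
    fun phi => P j.+1 phi /\ diff F j.+1 *m phi *m diff G j = 0
  else fun phi => P 0%N phi /\ lifts_id B phi.
have [|i phi Qphi|phi [Qphi Rphi]] := @dependent_choice _ Q
    (fun i phi psi => psi *m diff G i = diff F i *m phi).
- by exists phi0.
- have [N NE] : exists N, N *m diff G i = diff F i *m phi.
    apply: mulmx_lift; case: i phi Qphi => [|i] phi /= [_ Qphi] v.
      apply/G0; rewrite mulmxA; have := Qphi (v *m diff F 0).
      set a := _ 0 0 => Ba; have := resolution_diff_aug v resF.
      set b := _ 0 0 => Bb; suff -> : (v *m diff F 0 *m phi *m aug G) 0 0 = a - (0 - b).
        by apply: (BB) => //; apply: (BB).
      by rewrite /a /b !mxE; ring.
    by apply/GS; rewrite mulmxA -!mulmxA (mulmxA _ phi) Qphi mulmx0.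
  have [N' PN' N'E] := step i phi N (match i return forall phi, Q i phi -> P i phi
    with 0%N => fun _ => @proj1 _ _ | _ => fun _ => @proj1 _ _ end phi Qphi) NE.
  exists N'; split=> //=; split=> //.
  by rewrite -mulmxA N'E mulmxA (resolution_diff_diff _ resF) mul0mx.
- exists phi; split=> //; first by case: (Qphi 0%N).
  by case=> [|i]; [case: (Qphi 0%N)|case: (Qphi i.+1)].
Qed.

Lemma lifts_id_exists A B F G : is_ideal B ->
    is_resolution F A B -> is_resolution G A B ->
  exists phi : 'M_(rk F 0, rk G 0), lifts_id B phi.
Proof.
move=> Bid [Faug _ _ _] [_ Gsurj _ _].
have /fin_all_exists [f fE] (k : 'I_(rk F 0)) := Gsurj _ (Faug k).
exists (\matrix_k f k) => v.
have -> : (v *m \matrix_k f k *m aug G - v *m aug F) 0 0 =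
    \sum_k - v 0 k * (aug F k 0 - (f k *m aug G) 0 0).
  rewrite -mulmxA -mulmxBr mxE; apply: eq_bigr => k _.
  rewrite mulNr -mulrN opprB; congr (_ * _); rewrite !mxE; congr (_ - _).
  by apply: eq_bigr => j _; rewrite mxE.
by apply: is_ideal_sum => // k _; have [_ _] := Bid; apply.
Qed.

(** Each [h i.+1] lifts through [diff F i.+1] what remains of [chi i.+1 - 1%:M] after subtracting
    [diff F i *m h i]; this is a cycle because [chi] is a chain map. *)
Lemma chain_homotopy A B F (chi : forall i, 'M[R]_(rk F i)) :
    is_resolution F A B -> chain_map chi -> lifts_id B (chi 0%N) ->
  exists h : forall i, 'M[R]_(rk F i, rk F i.+1),
    chi 0%N - 1%:M = h 0%N *m diff F 0 /\
    forall i, chi i.+1 - 1%:M = diff F i *m h i + h i.+1 *m diff F i.+1.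
Proof.
move=> resF chi_map chi_lift; have [_ _ F0 FS] := resF.
(* The step relation only links [h i] to [h i.+1], so the equation for [h 0] is recorded in the
   invariant at [i = 0]. *)
pose Q i (h : 'M[R]_(rk F i, rk F i.+1)) :=
  (chi i.+1 - 1%:M - diff F i *m h) *m diff F i = 0 /\
  (if i is 0%N return 'M[R]_(rk F i, rk F i.+1) -> Prop then
    fun h => h *m diff F 0 = chi 0%N - 1%:M
  else fun _ => True) h.
have [|i h [Qh _]|h [Qh Rh]] := @dependent_choice _ Q
   
    (fun i h k => k *m diff F i.+1 = chi i.+1 - 1%:M - diff F i *m h).
- have [h hE] : exists h, h *m diff F 0 = chi 0%N - 1%:M.
    apply: mulmx_lift => v; apply/F0.
    by rewrite mulmxBr mulmx1 mulmxBl; exact: chi_lift.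
  exists h; split=> //.
  by rewrite mulmxBl -mulmxA hE mulmxBl mulmxBr chi_map mulmx1 mul1mx subrr.
- have [k kE] : exists k, k *m diff F i.+1 = chi i.+1 - 1%:M - diff F i *m h.
    by apply: mulmx_lift => v; apply/FS; rewrite -mulmxA Qh mulmx0.
  exists k; split=> //; split=> //.
  rewrite mulmxBl -mulmxA kE mulmxBr mulmxA (resolution_diff_diff _ resF) mul0mx.
  by rewrite mulmxBl mulmxBr chi_map mulmx1 mul1mx subr0 subrr.
- exists h; split=> [|i]; first by have [_ <-] := Qh 0%N.
  by rewrite Rh [RHS]addrC subrK.
Qed.

Local Notation mxK := (map_mx (mcoeff 0%MM)).

(** Over [K] the two homotopy terms send a cycle to a boundary, so the composite of the comparison
    maps fixes homology classes. *)
Lemma homotopy_equivalence A B F G (phi : forall i, 'M[R]_(rk F i, rk G i))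
    (psi : forall i, 'M[R]_(rk G i, rk F i)) :
    is_ideal B -> is_resolution F A B -> is_resolution G A B ->
    chain_map phi -> chain_map psi ->
    lifts_id B (phi 0%N) -> lifts_id B (psi 0%N) ->
  forall i (v : 'rV[K]_(rk F i)), cycleK v ->
  exists w, v *m mxK (phi i) *m mxK (psi i) = v + w *m diffK F i.
Proof.
move=> [B0 BB BM] resF resG phi_map psi_map phi_lift psi_lift.
have [|v|h [h0 hS]] := chain_homotopy (chi := fun i => phi i *m psi i) resF.
- by move=> i; rewrite -mulmxA psi_map mulmxA phi_map mulmxA.
- have := psi_lift (v *m phi 0%N); have := phi_lift v.
  set a := _ 0 0 => Ba; set b := _ 0 0 => Bb.
  have -> : (v *m (phi 0%N *m psi 0%N) *m aug F - v *m aug F) 0 0 = a - (0 - b).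
    by rewrite /a /b !mulmxA !mxE; ring.
  by apply: (BB) => //; apply: (BB).
case=> [|i] v cv; rewrite -mulmxA -map_mxM.
  exists (v *m mxK (h 0%N)); rewrite -[phi 0%N *m _](subrK 1%:M) h0 map_mxD map_mxM.
  by rewrite map_mx1 mulmxDr mulmx1 addrC mulmxA.
exists (v *m mxK (h i.+1)); rewrite -[phi i.+1 *m _](subrK 1%:M) hS !map_mxD !map_mxM.
by rewrite map_mx1 !mulmxDr mulmx1 addrC !mulmxA cv mul0mx add0r.
Qed.

(* Only the comparison map from [F] to [G] has to be graded: an inverse up to
   homotopy in the ungraded sense is enough to see that it is injective on
   homology. *)
Lemma homologyK_gdeg A F G i j :
    is_resolution F A (@ideal0 _) -> is_resolution G A (@ideal0 _) ->
    homologyK_neq0 F i j ->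
  exists l : 'I_(rk G i), gdeg l = j.
Proof.
move=> resF resG [v [vj cv nbv]].
pose P i (phi : 'M[R]_(rk F i, rk G i)) := homog_mx (@gdeg _ _ F i) (@gdeg _ _ G i) phi.
have [|k f N Pf NE|phi [phi_map phi_lift phiP]] :=
    chain_map_exists (P := P) (is_ideal0 _) resF resG.
- have [phi phi_lift] := lifts_id_exists (is_ideal0 _) resF resG.
  exists (homog_part_mx (@gdeg _ _ F 0) (@gdeg _ _ G 0) phi).
    exact: homog_part_mx_homog.
  (* As [B = 0], compatibility with the augmentations is an equality of matrices, and it passes to
     the graded part. *)
  have augE : phi *m aug G = aug F.
    apply/row_matrixP => k; apply/rowP => z; rewrite [z]ord1.
    by have := phi_lift (delta_mx 0 k); rewrite -mulmxA -mulmxBr -rowE => /eqP;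
      rewrite !mxE subr_eq0 => /eqP.
  have hG : homog_mx (@gdeg _ _ G 0) (fun=> 0) (aug G).
    by move=> k z; rewrite subr0; exact: aug_homog.
  have hF : homog_mx (@gdeg _ _ F 0) (fun=> 0) (aug F).
    by move=> k z; rewrite subr0; exact: aug_homog.
  move=> w; rewrite -mulmxA -(homog_part_mxM _ _ hG) augE homog_part_mx_id //.
  by rewrite subrr mxE.
- exists (homog_part_mx (@gdeg _ _ F k.+1) (@gdeg _ _ G k.+1) N).
    exact: homog_part_mx_homog.
  have hG : homog_mx (@gdeg _ _ G k.+1) (@gdeg _ _ G k) (diff G k).
    exact: diff_homog.
  rewrite -(homog_part_mxM _ _ hG) NE.
  by apply: homog_part_mx_id; apply: homog_mxM Pf; exact: diff_homog.
have [||psi [psi_map psi_lift _]] :=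
    chain_map_exists (P := fun _ _ => True) (is_ideal0 _) resG resF.
- by have [psi] := lifts_id_exists (is_ideal0 _) resG resF; exists psi.
- by move=> k f N _ NE; exists N.
have [w wE] := homotopy_equivalence (is_ideal0 _) resF resG phi_map psi_map
  phi_lift psi_lift cv.
(* The image of [v] is nonzero, as otherwise [v] would be a boundary. A nonzero coordinate [l] comes
   from an entry of [phi i] with nonzero constant term, whose degree [gdeg k - gdeg l] must be 0. *)
have /eqP/matrix0Pn [z [l]] : v *m mxK (phi i) <> 0.
  move=> v0; case: nbv; exists (- w); move: wE; rewrite v0 mul0mx mulNmx.
  by move/esym/eqP; rewrite addr_eq0 => /eqP.
rewrite mxE [z]ord1 => sum_neq0; exists l.
have [/existsP[k]|/existsPn none] := boolP [exists k, v 0 k * mxK (phi i) k l != 0].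
  rewrite mulf_eq0 negb_or => /andP[/vj <-]; rewrite mxE.
  have /homog_of_degreeP homk := phiP i k l.
  by move/homk; rewrite mdeg0 => /esym/eqP; rewrite subr_eq0 => /eqP.
by case/negP: sum_neq0; apply/eqP/big1 => k _; apply/eqP; have := none k; rewrite negbK.
Qed.

(** Over [K] the differentials of a minimal complex vanish: every vector is a cycle and only 0 is a
    boundary. The composite through the other resolution is thus an identity matrix, which bounds
    the rank. *)
Lemma minimal_resolution_rk A B F G i : is_ideal B ->
  is_minimal_resolution F A B -> is_minimal_resolution G A B -> rk F i = rk G i.
Proof.
move=> Bid [resF minF] [resG minG].
have exmap X Y : is_resolution X A B -> is_resolution Y A B ->
    exists phi : forall i, 'M[R]_(rk X i, rk Y i),
      chain_map phi /\ lifts_id B (phi 0%N).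
  move=> resX resY.
  have [||phi [phi_map phi_lift _]] :=
    chain_map_exists (P := fun _ _ => True) Bid resX resY; last by exists phi.
  - by have [phi] := lifts_id_exists Bid resX resY; exists phi.
  - by move=> k f N _ NE; exists N.
have leq_rk X Y : is_resolution X A B -> is_minimal X -> is_resolution Y A B ->
    (rk X i <= rk Y i)%N.
  move=> resX minX resY.
  have [phi [phi_map phi_lift]] := exmap X Y resX resY.
  have [psi [psi_map psi_lift]] := exmap Y X resY resX.
  apply: (@mulmx1_min _ _ _ (mxK (phi i)) (mxK (psi i))).
  apply/row_matrixP => k; rewrite row_mul !rowE mulmx1.
  have [|w ->] := homotopy_equivalence Bid resX resY phi_map psi_map
    phi_lift psi_lift (v := delta_mx 0 k); last by rewrite minX mulmx0 addr0.
  by case: (i) k => //= j k; rewrite minX mulmx0.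
by apply/eqP; rewrite eqn_leq !leq_rk.
Qed.

Lemma minimal_homologyK_gdeg F i (l : 'I_(rk F i)) : is_minimal F ->
  homologyK_neq0 F i (gdeg l).
Proof.
move=> minF; exists (delta_mx 0 l); split=> [k||[w]].
- by rewrite mxE eqxx /=; case: (k =P l) => [->|]; rewrite ?eqxx.
- by case: i l => //= i l; rewrite minF mulmx0.
- move/(congr1 (fun v : 'rV_ _ => v 0 l)); rewrite minF mulmx0 !mxE !eqxx => /eqP.
  by rewrite oner_eq0.
Qed.

End Comparison.

(** * Division by [T_i X_i - T'] *)

Section MonomialQuotient.
Variables (n : nat) (R : nzRingType).
Implicit Types (p : {mpoly R[n]}) (g h : {additive R -> R}) (t u k : 'X_{1..n}).

Lemma mcoeffXM u p k :
  ('X_[u] * p)@_k = if (u <= k)%MM then p@_(k - u) else 0.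
Proof.
rewrite -(commr_mpolyX u p); case: ifP => uk.
  by rewrite -{1}(submK uk) addmC mcoeffMX.
apply: memN_msupp_eq0; rewrite (perm_mem (msuppMX p u)).
by apply/mapP => -[m _ km]; rewrite km lem_addr in uk.
Qed.

(** For [g] the identity this divides by [X^t], dropping the monomials that [X^t] does not divide. A
    general [g] divides the coefficients at the same time. *)
Definition mquo g t p : {mpoly R[n]} :=
  \sum_(m : 'X_{1..n < msize p}) g p@_(m + t) *: 'X_[m].

Lemma mcoeff_mquo g t p k : (mquo g t p)@_k = g p@_(k + t).
Proof.
rewrite /mquo; case: (ltnP (mdeg k) (msize p)) => [|pk].
  exact: (mcoeff_mpoly (fun m => g p@_(m + t))).
rewrite (@memN_msupp_eq0 _ _ p (k + t)%MM) ?raddf0; last first.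
  by apply: msize_mdeg_ge; rewrite mdegD (leq_trans pk) ?leq_addr.
rewrite raddf_sum /= big1 // => m _; rewrite mcoeffZ mcoeffX.
case: eqP => [mk|]; last by rewrite mulr0.
by have := bmdeg m; rewrite mk ltnNge pk.
Qed.

Lemma mquo_is_additive g t : additive (mquo g t).
Proof.
by move=> p q; apply/mpolyP => k; rewrite mcoeffB !mcoeff_mquo mcoeffB raddfB.
Qed.

HB.instance Definition _ g t :=
  GRing.isAdditive.Build {mpoly R[n]} {mpoly R[n]} (mquo g t)
    (mquo_is_additive g t).

Lemma mquoXM t p : mquo (idfun : {additive R -> R}) t ('X_[t] * p) = p.
Proof. by apply/mpolyP => k; rewrite mcoeff_mquo mcoeffXM lem_addl addmK. Qed.

Lemma mquoXM_coprime g t u p : (forall i, u i = 0%N \/ t i = 0%N) ->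
  mquo g t ('X_[u] * p) = 'X_[u] * mquo g t p.
Proof.
move=> ut; apply/mpolyP => k; rewrite mcoeff_mquo !mcoeffXM mcoeff_mquo.
have -> : (u <= k + t)%MM = (u <= k)%MM.
  by apply/mnm_lepP/mnm_lepP => uk i; have := uk i; rewrite mnmDE;
     case: (ut i) => ->; rewrite ?addn0.
case: ifP => uk; rewrite ?raddf0 //; congr (g p@_ _).
apply/mnmP => i; rewrite !(mnmDE, mnmBE); have /mnm_lepP/(_ i) := uk.
by case: (ut i) => -> ?; lia.
Qed.

Lemma mquoC g h t u p : (forall x, g (h x) = h (g x)) ->
  mquo g t (mquo h u p) = mquo h u (mquo g t p).
Proof.
move=> gh; apply/mpolyP => k; rewrite !mcoeff_mquo gh; congr (h (g p@_ _)).
by rewrite -!addmA [(t + u)%MM]addmC.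
Qed.

Lemma mquoCM g t (c : R) p : (forall x, g (c * x) = c * g x) ->
  mquo g t (c%:MP * p) = c%:MP * mquo g t p.
Proof. by move=> gc; apply/mpolyP => k; rewrite mcoeff_mquo !mcoeffCM mcoeff_mquo gc. Qed.

Lemma msize_leP p d :
  reflect (forall m, p@_m != 0 -> (mdeg m < d)%N) (msize p <= d)%N.
Proof.
apply: (iffP idP) => [pd m|pd].
  by rewrite -mcoeff_msupp => /msize_mdeg_lt /leq_trans; apply.
by rewrite msizeE; apply/bigmax_leqP_seq => m; rewrite mcoeff_msupp => /pd.
Qed.

Lemma msize_mquo g t p : (msize (mquo g t p) <= msize p - mdeg t)%N.
Proof.
apply/msize_leP => m; rewrite mcoeff_mquo => gp.
have /msize_mdeg_lt : (m + t)%MM \in msupp p.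
  by rewrite mcoeff_msupp; apply: contraNneq gp => ->; rewrite raddf0.
by rewrite mdegD; lia.
Qed.

End MonomialQuotient.

Section LinearQuotient.
Variables (n : nat) (R : idomainType) (T : 'I_n -> R) (T' : R).
Variable dv : 'I_n -> {additive R -> R}.
Hypotheses
  (dvK : forall i a, dv i (T i * a) = a)
  (dvM : forall i j a, i != j -> dv i (T j * a) = T j * dv i a)
  (dvM' : forall i a, dv i (T' * a) = T' * dv i a)
  (dvC : forall i j a, dv i (dv j a) = dv j (dv i a)).
Local Notation S := {mpoly R[n]}.

Definition lin (i : 'I_n) : S := (T i)%:MP * 'X_i - T'%:MP.
(** The quotient by the leading term [T i * X_i] alone; the remainders for [lin i] are the elements
    of its kernel. *)
Definition linquo1 i : S -> S := mquo (dv i) U_(i).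
HB.instance Definition _ i := GRing.Additive.on (linquo1 i).

(* Division by [T i * X_i - T'] with leading term [T i * X_i]; the bound [N] on
   the number of steps is irrelevant once it exceeds the degree. *)
Definition linquo (N : nat) i (p : S) : S :=
  \sum_(j < N) (T' ^+ j)%:MP * iter j.+1 (linquo1 i) p.

Lemma linquo1_C i p : linquo1 i (T'%:MP * p) = T'%:MP * linquo1 i p.
Proof. exact/mquoCM/dvM'. Qed.

Lemma linquo1_lin i p : linquo1 i (lin i * p) = p - T'%:MP * linquo1 i p.
Proof.
rewrite mulrBl raddfB /= linquo1_C; congr (_ - _); apply/mpolyP => m.
by rewrite mcoeff_mquo -mulrA mcoeffCM mcoeffXM lem_addl addmK dvK.
Qed.

Lemma linquo1_lin_neq i j p : i != j ->
  linquo1 i (lin j * p) = lin j * linquo1 i p.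
Proof.
move=> ij; rewrite !mulrBl raddfB /= linquo1_C; congr (_ - _).
rewrite -!mulrA /linquo1 mquoCM => [|x]; last exact: dvM.
rewrite mquoXM_coprime // => k; rewrite !mnm1E.
by case: (j =P k) => [<-|]; [right; case: eqP ij|left].
Qed.

Lemma linquo1C i j p : linquo1 i (linquo1 j p) = linquo1 j (linquo1 i p).
Proof. exact: mquoC. Qed.

Lemma msize_linquo1 i p : (msize (linquo1 i p) <= (msize p).-1)%N.
Proof. by rewrite (leq_trans (msize_mquo _ _ _)) // mdeg1 subn1. Qed.

Lemma msize_iter_linquo1 k i p : (msize (iter k (linquo1 i) p) <= msize p - k)%N.
Proof.
elim: k => [|k IHk] /=; first by rewrite subn0.
by rewrite (leq_trans (msize_linquo1 _ _)) //; lia.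
Qed.

Lemma iter_linquo1_eq0 N i p : (msize p <= N)%N -> iter N (linquo1 i) p = 0.
Proof.
move=> pN; apply/eqP; rewrite -msize_poly_eq0 -leqn0.
by rewrite (leq_trans (msize_iter_linquo1 _ _ _)) // leqn0 subn_eq0.
Qed.

Lemma iter_linquo1B k i p q :
  iter k (linquo1 i) (p - q) = iter k (linquo1 i) p - iter k (linquo1 i) q.
Proof. by elim: k => //= k ->; rewrite raddfB. Qed.

Lemma iter_comm (U : Type) (f g : U -> U) k x :
  (forall y, f (g y) = g (f y)) -> iter k f (g x) = g (iter k f x).
Proof. by move=> fg; elim: k => //= k ->. Qed.

Lemma linquo_is_additive N i : additive (linquo N i).
Proof.
move=> p q; rewrite /linquo -sumrB; apply: eq_bigr => j _.
by rewrite iter_linquo1B mulrBr.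
Qed.
HB.instance Definition _ N i :=
  GRing.isAdditive.Build S S (linquo N i) (linquo_is_additive N i).

(** With [L = linquo1 i], multiplication by [lin i] followed by [L] is [1 - T' L], and [linquo] is
    [L] followed by the geometric series for the inverse of [1 - T' L]. The sum telescopes, and
    [L ^ N] kills [p] because [L] lowers degrees. *)
Lemma linquoK N i p : (msize p <= N)%N -> linquo N i (lin i * p) = p.
Proof.
move=> pN; rewrite /linquo -(big_mkord xpredT
  (fun j => (T' ^+ j)%:MP * iter j.+1 (linquo1 i) (lin i * p))).
rewrite (@telescope_sumr_eq _ _ _ (fun k => - ((T' ^+ k)%:MP * iter k (linquo1 i) p))) //.
  by rewrite iter_linquo1_eq0 // mulr0 oppr0 opprK expr0 mpolyC1 mul1r add0r.
move=> k _; rewrite opprK iterSr linquo1_lin iter_linquo1B.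
rewrite (iter_comm _ _ (linquo1_C i)) -iterSr mulrBr mulrA -mpolyCM -exprSr.
by rewrite addrC.
Qed.

Lemma linquo_lin_neq N i j p : i != j ->
  linquo N i (lin j * p) = lin j * linquo N i p.
Proof.
move=> ij; rewrite /linquo mulr_sumr; apply: eq_bigr => k _.
rewrite (iter_comm _ _ (fun y => linquo1_lin_neq y ij)); ring.
Qed.

Lemma linquo_linquo1 N i j p : linquo1 j (linquo N i p) = linquo N i (linquo1 j p).
Proof.
rewrite /linquo raddf_sum; apply: eq_bigr => k _.
rewrite (iter_comm k.+1 _ (linquo1C i j)); move: (iter _ _ _) => x.
apply: mquoCM => c.
by elim: (k : nat) c => [|l IHl] c; rewrite ?mul1r // exprS -!mulrA dvM' IHl.
Qed.

(** The same telescoping gives [(1 - T' L) (linquo N i p) = L p], and the left side is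
    [L (lin i * linquo N i p)]. *)
Lemma linquo1_rem N i p : (msize p <= N)%N ->
  linquo1 i (p - lin i * linquo N i p) = 0.
Proof.
move=> pN; rewrite raddfB /= linquo1_lin linquo_linquo1.
apply/eqP; rewrite subr_eq0; apply/eqP.
rewrite /linquo mulr_sumr -sumrB -(big_mkord xpredT
  (fun j => (T' ^+ j)%:MP * iter j.+1 (linquo1 i) p -
            T'%:MP * ((T' ^+ j)%:MP * iter j.+1 (linquo1 i) (linquo1 i p)))).
rewrite (@telescope_sumr_eq _ _ _
  (fun k => - ((T' ^+ k)%:MP * iter k.+1 (linquo1 i) p))) //.
  rewrite iterSr iter_linquo1_eq0; last first.
    by rewrite (leq_trans (msize_linquo1 _ _)) // (leq_trans (leq_pred _)).
  by rewrite mulr0 oppr0 opprK expr0 mpolyC1 mul1r add0r.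
by move=> k _; rewrite opprK mulrA -mpolyCM -exprS -iterSr addrC.
Qed.

(** Division by one element keeps a remainder for another, so successive divisions end in a common
    remainder. *)
Lemma linquo1_rem_neq N i j p : i != j -> linquo1 j p = 0 ->
  linquo1 j (p - lin i * linquo N i p) = 0.
Proof.
move=> ij p0; rewrite raddfB /= linquo1_lin_neq 1?eq_sym // linquo_linquo1 p0.
by rewrite raddf0 mulr0 subr0.
Qed.

Lemma msize_mulC_le (c : R) (p : S) : (msize (c%:MP * p) <= msize p)%N.
Proof. by rewrite mul_mpolyC; exact: mmeasureZ_le. Qed.

Lemma msize_linquo N i p : (msize (linquo N i p) <= (msize p).-1)%N.
Proof.
apply: leq_trans (msize_sum _ _ _) _; apply/bigmax_leqP => j _.
rewrite (leq_trans (msize_mulC_le _ _)) //.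
by rewrite (leq_trans (msize_iter_linquo1 _ _ _)) //; lia.
Qed.

Lemma lin_neq0 i : lin i != 0.
Proof.
have T0 : T i != 0.
  apply/eqP => T0; have := dvK i 1; rewrite T0 mul0r raddf0.
  by move/eqP; rewrite eq_sym oner_eq0.
apply/eqP => /(congr1 (mcoeff U_(i))); rewrite mcoeffB mcoeffCM mcoeffX eqxx.
by rewrite mcoeffC mnm1_eq0 mulr0 mulr1 subr0 mcoeff0 => /eqP; apply/negP.
Qed.

Lemma msize_lin i : (msize (lin i) <= 2)%N.
Proof.
apply: leq_trans (msizeD_le _ _) _; rewrite geq_max msizeN msizeC.
rewrite (leq_trans (msize_mulC_le _ _)) ?msizeX ?mdeg1 //.
by case: (T' != 0).
Qed.

Lemma msize_linM i k (p : S) : (msize p <= k)%N -> (msize (lin i * p) <= k.+1)%N.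
Proof.
move=> pk; have [->|p0] := eqVneq p 0; first by rewrite mulr0 msize0.
by rewrite msizeM ?lin_neq0 //; have := msize_lin i; lia.
Qed.

Lemma msize_rem N i k (p : S) : (msize p <= k)%N ->
  (msize (p - lin i * linquo N i p)%R <= k)%N.
Proof.
move=> pk; have [->|p0] := eqVneq p 0; first by rewrite raddf0 mulr0 subr0 msize0.
apply: leq_trans (msizeD_le _ _) _; rewrite geq_max pk msizeN.
rewrite (leq_trans (msize_linM i (msize_linquo N i p))) // (leq_trans _ pk) //.
by rewrite prednK // lt0n msize_poly_eq0.
Qed.

Lemma linMI i (p q : S) : lin i * p = lin i * q -> p = q.
Proof. exact: (mulfI (lin_neq0 i)). Qed.

(** * The substitution [X_i := T' / T i] and its injectivity on remainders *)

Section Weights.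
Variable s : nat.
Hypothesis T'_neq0 : T' != 0.

(** This is the generator of the power of the ideal for the exponents [a_i = m i] and, for the
    factor [T'], [a = s - mdeg m]; so [T'] occurs to the power [s - a = mdeg m]. *)
Definition weight (m : 'X_{1..n}) : R :=
  \prod_(i < n) T i ^+ (s - m i) * T' ^+ mdeg m.

(* Since [T i * weight (m + U_(i)) = T' * weight m], this is the substitution
   [X_i := T' / T i] cleared of denominators. *)
Definition weight_eval (p : S) : R :=
  \sum_(m : 'X_{1..n < s.+1}) p@_m * weight m.

Lemma weight_eval_is_linear : scalar weight_eval.
Proof.
move=> c p q; rewrite /weight_eval mulr_sumr -big_split /=; apply: eq_bigr => m _.
by rewrite mcoeffD mcoeffZ; ring.
Qed.
HB.instance Definition _ :=
  GRing.isLinear.Build R S R *%R weight_eval weight_eval_is_linear.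

Lemma weight_evalX (m : 'X_{1..n}) : (mdeg m <= s)%N ->
  weight_eval 'X_[m] = weight m.
Proof.
move=> ms; rewrite /weight_eval (bigD1 (BMultinom (ms : mdeg m < s.+1)%N)) //=.
rewrite mcoeffX eqxx mul1r big1 ?addr0 // => k km; rewrite mcoeffX.
by case: (m =P k) => [mk|]; rewrite ?mul0r //; case/eqP: km; apply/val_inj.
Qed.

Lemma weightDU i (m : 'X_{1..n}) : (mdeg m < s)%N ->
  T i * weight (U_(i) + m) = T' * weight m.
Proof.
move=> ms; have mis : (m i < s)%N.
  by rewrite (leq_ltn_trans _ ms) // mdegE (bigD1 i) //= leq_addr.
rewrite /weight mdegD mdeg1 exprS !(bigD1 (P := xpredT) i) //= mnmDE mnm1E eqxx.
rewrite (eq_bigr (fun j => T j ^+ (s - m j))) => [|j ji]; last first.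
  by rewrite mnmDE mnm1E eq_sym (negbTE ji).
have -> : (s - m i = (s - (true + m i)).+1)%N by lia.
by rewrite exprS; ring.
Qed.

Lemma weight_eval_lin i p : (msize p <= s)%N -> weight_eval (lin i * p) = 0.
Proof.
move=> ps; rewrite (mpolywE ps) mulr_sumr linear_sum big1 //= => m _.
rewrite -scalerAr linearZ /= mulrBl -mulrA -mpolyXD !mul_mpolyC linearB !linearZ /=.
rewrite !weight_evalX ?mdegD ?mdeg1 ?bmdeg //; last exact/ltnW/bmdeg.
by rewrite weightDU ?bmdeg // subrr mulr0.
Qed.

Definition dvs (e : 'I_n -> nat) (l : seq 'I_n) (x : R) : R :=
  foldr (fun i y => iter (e i) (dv i) y) x l.

Lemma iter_dvM k i j l x : i != j ->
  iter k (dv i) (T j ^+ l * x) = T j ^+ l * iter k (dv i) x.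
Proof.
move=> ij; elim: l x => [|l IHl] x; rewrite ?mul1r // exprS -!mulrA -IHl.
by rewrite (iter_comm _ _ (fun a => dvM a ij)).
Qed.

Lemma iter_dvM_prod k i d l x : i \notin l ->
  iter k (dv i) (\prod_(j <- l) T j ^+ d j * x) =
  \prod_(j <- l) T j ^+ d j * iter k (dv i) x.
Proof.
elim: l => [|j l IHl]; rewrite ?big_nil ?mul1r // inE negb_or => /andP[ij /IHl lE].
by rewrite !big_cons -!mulrA iter_dvM // lE.
Qed.

Lemma iter_dvK k i l x :
  iter k (dv i) (T i ^+ l * x) = T i ^+ (l - k) * iter (k - l) (dv i) x.
Proof.
elim: l k => [|l IHl] [|k]; rewrite ?mul1r ?subn0 //.
by rewrite iterSr exprS -mulrA dvK IHl.
Qed.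

Lemma iter_dvB k i : {morph iter k (dv i) : x y / x - y}.
Proof. by move=> x y; elim: k => //= k ->; rewrite raddfB. Qed.

Lemma dvs_is_additive e l : additive (dvs e l).
Proof. by move=> x y; elim: l => //= i l ->; rewrite iter_dvB. Qed.
HB.instance Definition _ e l :=
  GRing.isAdditive.Build R R (dvs e l) (dvs_is_additive e l).

Lemma dvs_comm e l (f : R -> R) x : (forall i y, i \in l -> dv i (f y) = f (dv i y)) ->
  dvs e l (f x) = f (dvs e l x).
Proof.
elim: l => //= i l IHl fC; rewrite IHl => [|j y jl]; last first.
  by apply: fC; rewrite inE jl orbT.
by apply: iter_comm => y; rewrite fC ?mem_head.
Qed.

(** For each [i], powers of [T i] and divisions cancel; one of the two truncated differences is 0,
    and surplus divisions fall on [x]. *)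
Lemma dvs_prod e d l x : uniq l ->
  dvs e l (\prod_(i <- l) T i ^+ d i * x) =
  \prod_(i <- l) T i ^+ (d i - e i) * dvs (fun i => e i - d i)%N l x.
Proof.
elim: l x => [|i l IHl] x /=; first by rewrite !big_nil.
case/andP=> il ul; rewrite !big_cons -mulrA (dvs_comm _ (f := *%R (T i ^+ d i))).
  by rewrite IHl // iter_dvK -mulrA iter_dvM_prod.
move=> j y jl; rewrite -[dv j _]/(iter 1 (dv j) _) iter_dvM //.
by apply: contraNneq il => <-.
Qed.

Lemma dvs_eq0 e l i x : i \in l -> (0 < e i)%N -> dv i x = 0 -> dvs e l x = 0.
Proof.
move=> il ei xi0; elim: l il => //= j l IHl; rewrite inE => /orP[/eqP <-|/IHl ->].
  case: (e i) ei => // k _; rewrite iterSr -(dvs_comm e (f := dv i)) ?xi0 //.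
  rewrite raddf0; elim: k => //= k ->; exact: raddf0.
by elim: (e j) => //= k ->; rewrite raddf0.
Qed.

(* The coefficient of [X^m] is isolated by dividing by [\prod_i T i ^+ (s - m i)]:
   the terms with an exponent [k i > m i] are killed because [dv i] kills their
   coefficients, and the remaining ones have smaller degree. *)
Lemma weight_eval_inj p : (msize p <= s.+1)%N ->
  (forall i, linquo1 i p = 0) -> weight_eval p = 0 -> p = 0.
Proof.
move=> ps p_rem p0; apply/mpolyP => m; rewrite mcoeff0.
have [d] := ubnP (mdeg m); elim: d m => // d IHd m md.
case: (leqP (mdeg m) s) => [ms|sm]; last first.
  by apply: memN_msupp_eq0; apply: msize_mdeg_ge; exact: leq_trans sm.
have m_le (k : 'X_{1..n}) i : (mdeg k <= s)%N -> (k i <= s)%N.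
  by apply: leq_trans; rewrite mdegE (bigD1 i) //= leq_addr.
have dv_weight (k : 'X_{1..n}) :
    dvs (fun i => s - m i)%N (index_enum 'I_n) (p@_k * weight k) =
    \prod_i T i ^+ ((s - k i) - (s - m i)) *
      dvs (fun i => (s - m i) - (s - k i))%N (index_enum 'I_n) (T' ^+ mdeg k * p@_k).
  by rewrite -dvs_prod ?index_enum_uniq // /weight mulrC mulrA.
have := congr1 (dvs (fun i => s - m i)%N (index_enum 'I_n)) p0.
rewrite raddf0 raddf_sum (bigD1 (BMultinom (ms : mdeg m < s.+1)%N)) //= big1 => [|k km].
  rewrite addr0 dv_weight big1 ?mul1r => [|i _]; last by rewrite subnn.
  rewrite (_ : dvs _ _ _ = T' ^+ mdeg m * p@_m) => [/eqP|].
    by rewrite mulf_eq0 expf_eq0 (negbTE T'_neq0) andbF /= => /eqP.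
  by elim: (index_enum _) => //= i l ->; rewrite subnn.
rewrite dv_weight; have [/existsP[i mk]|/existsPn kmle] := boolP [exists i, m i < k i]%N.
  rewrite (dvs_eq0 (i := i)) ?mulr0 ?mem_index_enum //.
    by have := m_le k i (bmdeg k); move: (bmdeg k) mk; lia.
  have -> : dv i (T' ^+ mdeg k * p@_k) = T' ^+ mdeg k * dv i p@_k.
    by elim: (mdeg k) p@_k => [|l IHl] x; rewrite ?mul1r // exprS -!mulrA dvM' IHl.
  (* As [X_i] divides [X^k], [dv i p@_k] is a coefficient of [linquo1 i p], hence zero. *)
  have Uik : (U_(i) <= k)%MM by rewrite lep1mP -lt0n (leq_trans _ mk).
  by rewrite -(submK Uik) -mcoeff_mquo -/(linquo1 i p) p_rem mcoeff0 mulr0.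
have {}kmle : (k <= m)%MM by apply/mnm_lepP => i; rewrite leqNgt kmle.
rewrite IHd ?mulr0 ?raddf0 ?mulr0 // (leq_trans _ (md : mdeg m <= d)%N) //.
rewrite -(submK kmle) mdegD -[X in (X < _)%N]add0n ltn_add2r lt0n mdeg_eq0.
apply: contraNneq km => mk0; apply/eqP/val_inj => /=.
by rewrite -(submK kmle) mk0 add0m.
Qed.
End Weights.

End LinearQuotient.

(** * The Koszul strand *)

Section KoszulMatrices.
Variables (S : comNzRingType) (f : 'I_3 -> S).
Local Notation f0 := (f ord0).
Local Notation f1 := (f (lift ord0 ord0)).
Local Notation f2 := (f (lift ord0 (lift ord0 ord0))).

Definition koszul_rank (p : nat) : nat := nth 0%N [:: 1; 3; 3; 1]%N p.

(* Row vectors: the three middle coordinates of degree 2 are indexed by the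
   pairs 01, 02, 12. *)
Definition koszul_diff (p : nat) : 'M[S]_(koszul_rank p.+1, koszul_rank p) :=
  \matrix_(i, j) nth 0 (nth [::] (nth [::]
    [:: [:: [:: f0]; [:: f1]; [:: f2]];
        [:: [:: - f1; f0; 0]; [:: - f2; 0; f0]; [:: 0; - f2; f1]];
        [:: [:: f2; - f1; f0]]] p) i) j.

Lemma koszul_diff_diff p : koszul_diff p.+1 *m koszul_diff p = 0.
Proof.
case: p => [|[|p]]; apply/matrixP => i j.
- case: i => [[|[|[|//]]]] ?; case: j => [[|//]] ?;
  by rewrite !mxE !big_ord_recl big_ord0 !mxE /=; ring.
- case: i => [[|//]] ?; case: j => [[|[|[|//]]]] ?;
  by rewrite !mxE !big_ord_recl big_ord0 !mxE /=; ring.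
- suff : (i < 0)%N by [].
  by apply: leq_trans (ltn_ord i) _; rewrite /koszul_rank /= nth_nil.
Qed.

(** A uniform shape for the entries, with [c] one of 0, 1, -1, so that sizes, degrees and minimality
    are checked without going through the matrices. *)
Lemma koszul_diff_entry p i j : exists (c : int) (k : 'I_3),
  koszul_diff p i j = c%:~R * f k.
Proof.
have f_entry k : exists (c : int) l, f k = c%:~R * f l.
  by exists 1, k; rewrite mul1r.
have Nf_entry k : exists (c : int) l, - f k = c%:~R * f l.
  by exists (-1), k; rewrite mulN1r.
have entry0 : exists (c : int) l, 0 = c%:~R * f l.
  by exists 0, ord0; rewrite mul0r.
rewrite mxE; case: p i j => [|[|[|p]]] i j.
- by case: i => [[|[|[|//]]]] ?; case: j => [[|//]] ?; exact: f_entry.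
- case: i => [[|[|[|//]]]] ?; case: j => [[|[|[|//]]]] ?;
  by [exact: f_entry|exact: Nf_entry|exact: entry0].
- case: i => [[|//]] ?; case: j => [[|[|[|//]]]] ?;
  by [exact: f_entry|exact: Nf_entry].
- by rewrite /= !nth_nil.
Qed.
End KoszulMatrices.

(** * Exactness of the Koszul complex with control of degrees *)

Section KoszulExact.
Variables (R : idomainType) (T : 'I_3 -> R) (T' : R).
Variable dv : 'I_3 -> {additive R -> R}.
Hypotheses
  (dvK : forall i a, dv i (T i * a) = a)
  (dvM : forall i j a, i != j -> dv i (T j * a) = T j * dv i a)
  (dvM' : forall i a, dv i (T' * a) = T' * dv i a)
  (dvC : forall i j a, dv i (dv j a) = dv j (dv i a)).
Local Notation S := {mpoly R[3]}.
Local Notation lin := (lin T T').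
Local Notation i0 := (ord0 : 'I_3).
Local Notation i1 := (lift ord0 ord0 : 'I_3).
Local Notation i2 := (lift ord0 (lift ord0 ord0) : 'I_3).

(** Division by one [lin i] commutes with multiplication by the others, so applying it to a relation
    solves for a coordinate. The drop from [k] to [k.-1] makes each strand exact by itself. *)
Lemma koszul_exact p k (a : 'rV[S]_(koszul_rank p.+1)) :
    (forall i, (msize (a 0%R i) <= k)%N) -> a *m koszul_diff lin p = 0 ->
  exists2 b : 'rV[S]_(koszul_rank p.+2), (forall i, (msize (b 0%R i) <= k.-1)%N) &
    a = b *m koszul_diff lin p.+1.
Proof.
pose q := linquo T' dv k.
have qK i x : (msize x <= k)%N -> q i (lin i * x) = x by exact: linquoK.
have qM i j x : i != j -> q i (lin j * x) = lin j * q i x by exact: linquo_lin_neq.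
have qD i x y : q i (x + y) = q i x + q i y by exact: raddfD.
have qN i x : q i (- x) = - q i x by exact: raddfN.
have q0 i : q i 0 = 0 by exact: raddf0.
have linI i x y : lin i * x = lin i * y -> x = y by exact: (linMI dvK).
have q_size i x : (msize x <= k)%N -> (msize (q i x) <= k.-1)%N.
  move=> xk; apply: leq_trans (msize_linquo _ _ _ _ _) _.
  by rewrite -!subn1 leq_sub2r.
have rem_size i x : (msize x <= k)%N -> (msize (x - lin i * q i x)%R <= k)%N.
  by exact: msize_rem.
clearbody q; move=> a_size /rowP a0; case: p a a_size a0 => [|[|[|p]]] /= a a_size a0.
- have := a0 ord0; rewrite !mxE !big_ord_recl big_ord0 !mxE /= addr0.
  rewrite -[ord0]/i0; set a_0 := a 0 _; set a_1 := a 0 _; set a_2 := a 0 _ => e.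
  have e0 : a_0 + lin i1 * q i0 a_1 + lin i2 * q i0 a_2 = 0.
    have := congr1 (q i0) e; rewrite !qD q0 !(mulrC _ (lin _)).
    by rewrite qK ?a_size // (qM i0 i1) // (qM i0 i2) // addrA.
  (* Subtracting [lin i0] times [e0] from the relation leaves one between [lin i1] and [lin i2]
     alone, with these remainders as coefficients. *)
  set r1 := a_1 - lin i0 * q i0 a_1; set r2 := a_2 - lin i0 * q i0 a_2.
  have e1 : lin i1 * r1 + lin i2 * r2 = 0.
    have -> : lin i1 * r1 + lin i2 * r2 =
        (a_0 * lin i0 + (a_1 * lin i1 + a_2 * lin i2)) -
        lin i0 * (a_0 + lin i1 * q i0 a_1 + lin i2 * q i0 a_2).
      by rewrite /r1 /r2; ring.
    by rewrite e e0 mulr0 subr0.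
  have e2 : r1 + lin i2 * q i1 r2 = 0.
    have := congr1 (q i1) e1; rewrite qD q0 qK ?rem_size ?a_size //.
    by rewrite (qM i1 i2).
  have e3 : r2 = lin i1 * q i1 r2.
    apply: (linI i2); apply/eqP; rewrite -subr_eq0; apply/eqP.
    have -> : lin i2 * r2 - lin i2 * (lin i1 * q i1 r2) =
      (lin i1 * r1 + lin i2 * r2) - lin i1 * (r1 + lin i2 * q i1 r2) by ring.
    by rewrite e1 e2 mulr0 subr0.
  exists (\row_j nth 0 [:: q i0 a_1; q i0 a_2; q i1 r2] j).
    case=> [[|[|[|//]]]] ?; rewrite mxE /=; do ?exact/q_size/a_size.
    by apply/q_size/rem_size/a_size.
  apply/rowP => -[[|[|[|//]]] jlt]; rewrite !mxE !big_ord_recl big_ord0 !mxE /=.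
  + rewrite (_ : Ordinal _ = i0); last exact: val_inj.
    rewrite -/a_0; transitivity (a_0 -
      (a_0 + lin i1 * q i0 a_1 + lin i2 * q i0 a_2)); last by ring.
    by rewrite e0 subr0.
  + rewrite (_ : Ordinal _ = i1); last exact: val_inj.
    rewrite -/a_1; transitivity (a_1 - (r1 + lin i2 * q i1 r2)).
      by rewrite e2 subr0.
    by rewrite /r1; ring.
  + rewrite (_ : Ordinal _ = i2); last exact: val_inj.
    rewrite -/a_2; transitivity (r2 + lin i0 * q i0 a_2).
      by rewrite /r2 subrK.
    by rewrite {1}e3; ring.
- pose b01 : S := a 0 i0; pose b02 : S := a 0 i1; pose b12 : S := a 0 i2.
  have e1 : lin i0 * b02 + lin i1 * b12 = 0.
    have := a0 i2; rewrite !mxE !big_ord_recl big_ord0 !mxE /= => <-.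
    by rewrite -/b01 -/b02 -/b12; ring.
  have e2 : lin i0 * b01 + lin i2 * - b12 = 0.
    have := a0 i1; rewrite !mxE !big_ord_recl big_ord0 !mxE /= => <-.
    by rewrite -/b01 -/b02 -/b12; ring.
  have b02E : b02 + lin i1 * q i0 b12 = 0.
    have := congr1 (q i0) e1; rewrite qD q0.
    by rewrite qK ?a_size // (qM i0 i1).
  have b01E : b01 - lin i2 * q i0 b12 = 0.
    have := congr1 (q i0) e2; rewrite qD q0.
    by rewrite qK ?a_size // (qM i0 i2) // qN mulrN.
  have b12E : b12 = lin i0 * q i0 b12.
    apply: (linI i2); apply/eqP; rewrite -subr_eq0; apply/eqP.
    have -> : lin i2 * b12 - lin i2 * (lin i0 * q i0 b12) =
        lin i0 * (b01 - lin i2 * q i0 b12) - (lin i0 * b01 + lin i2 * - b12) by ring.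
    by rewrite e2 b01E mulr0 subr0.
  exists (\row_j q i0 b12) => [j|]; first by rewrite mxE; exact/q_size/a_size.
  apply/rowP => -[[|[|[|//]]] jlt]; rewrite !mxE !big_ord_recl big_ord0 !mxE /= addr0.
  + rewrite (_ : Ordinal _ = i0); last exact: val_inj.
    by rewrite -/b01 mulrC; apply/eqP; rewrite -subr_eq0 b01E.
  + rewrite (_ : Ordinal _ = i1); last exact: val_inj.
    rewrite -/b02; transitivity (b02 - (b02 + lin i1 * q i0 b12)); last by ring.
    by rewrite b02E subr0.
  + rewrite (_ : Ordinal _ = i2); last exact: val_inj.
    by rewrite -/b12 mulrC.
- exists 0 => [i|]; first by rewrite mxE msize0.
  rewrite mul0mx; apply/rowP => -[[|//] jlt]; rewrite mxE.
  have := a0 i0; rewrite !mxE !big_ord_recl big_ord0 !mxE /= addr0 => /eqP.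
  rewrite mulf_eq0 (negbTE (lin_neq0 _ dvK _)) orbF => /eqP <-.
  by congr (a _ _); exact: val_inj.
- exists 0 => [i|]; first by rewrite mxE msize0.
  apply/rowP => i; suff : (i < 0)%N by [].
  by apply: leq_trans (ltn_ord i) _; rewrite /koszul_rank /= nth_nil.
Qed.

(** Three successive divisions leave a common remainder on which the substitution still vanishes. By
    [weight_eval_inj] it is zero, and the quotients form [b]. *)
Lemma weight_eval_exact s (p : S) : T' != 0 ->
    (msize p <= s.+1)%N -> weight_eval T T' s p = 0 ->
  exists2 b : 'rV[S]_(koszul_rank 1), (forall i, (msize (b 0%R i) <= s)%N) &
    p = (b *m koszul_diff lin 0) 0 0.
Proof.
move=> T'0 p_size p_eval; pose q := linquo T' dv s.+1.
have q_size i x : (msize x <= s.+1)%N -> (msize (q i x) <= s)%N.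
  move=> xs; apply: leq_trans (msize_linquo _ _ _ _ _) _.
  by rewrite -subn1 leq_subLR add1n.
pose rem i x := x - lin i * q i x.
have rem_size i x : (msize x <= s.+1)%N -> (msize (rem i x) <= s.+1)%N.
  by exact: msize_rem.
have rem_eval i x : (msize x <= s.+1)%N -> weight_eval T T' s x = 0 ->
    weight_eval T T' s (rem i x) = 0.
  by move=> xs x0; rewrite raddfB /= x0 weight_eval_lin ?subr0 ?q_size.
have rem1 j x : (msize x <= s.+1)%N -> linquo1 dv j (rem j x) = 0.
  by exact: linquo1_rem.
have rem1_neq j k x : k != j -> linquo1 dv j x = 0 -> linquo1 dv j (rem k x) = 0.
  by exact: linquo1_rem_neq.
have remE i x : x = lin i * q i x + rem i x by rewrite /rem addrC subrK.
clearbody rem q; set p1 := rem i0 p; set p2 := rem i1 p1.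
have p1_size : (msize p1 <= s.+1)%N := rem_size i0 p p_size.
have p2_size : (msize p2 <= s.+1)%N := rem_size i1 p1 p1_size.
have p1_eval : weight_eval T T' s p1 = 0 := rem_eval i0 p p_size p_eval.
have p2_eval : weight_eval T T' s p2 = 0 := rem_eval i1 p1 p1_size p1_eval.
have p3_eq0 : rem i2 p2 = 0.
  apply: (weight_eval_inj dvK dvM dvM' dvC T'0 (rem_size i2 p2 p2_size) _
    (rem_eval i2 p2 p2_size p2_eval)) => -[[|[|[|//]]] ilt].
  - rewrite (_ : Ordinal _ = i0); last exact: val_inj.
    by apply: (rem1_neq) => //; apply: (rem1_neq) => //; exact: rem1.
  - rewrite (_ : Ordinal _ = i1); last exact: val_inj.
    by apply: (rem1_neq) => //; exact: rem1.
  - by rewrite (_ : Ordinal _ = i2); [exact: rem1|exact: val_inj].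
exists (\row_j nth 0 [:: q i0 p; q i1 p1; q i2 p2] j).
  by case=> [[|[|[|//]]]] ?; rewrite mxE /=; exact: q_size.
rewrite !mxE !big_ord_recl big_ord0 !mxE /= [LHS](remE i0) -/p1 [in LHS](remE i1 p1).
by rewrite -/p2 [in LHS](remE i2 p2) p3_eq0; ring.
Qed.

(** * The strand of bounded degree as a complex of free modules *)

Section Strand.
Variable s : nat.

(* [(i, X^m)] with [mdeg m <= s - p]; the truncated bound [s.+1 - p] makes the
   index set empty for [p > s]. *)
Definition strand_index (p : nat) : finType :=
  ('I_(koszul_rank p) * 'X_{1..3 < s.+1 - p})%type.

Definition strand_rank p := #|strand_index p|.

Definition strand_val p (k : 'I_(strand_rank p)) : strand_index p := enum_val k.

Definition strand_diff p : 'M[R]_(strand_rank p.+1, strand_rank p) :=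
  \matrix_(k, l) (koszul_diff lin p (strand_val k).1 (strand_val l).1 *
                   'X_[(strand_val k).2])@_(strand_val l).2.

Definition strand_aug : 'cV[R]_(strand_rank 0) :=
  \col_k weight T T' s (strand_val k).2.

(** Identifies coordinate vectors with rows of polynomials of degree at most [s - p]; exactness is
    transported through it. *)
Definition to_koszul p (v : 'rV[R]_(strand_rank p)) : 'rV[S]_(koszul_rank p) :=
  \row_i \sum_(m : 'X_{1..3 < s.+1 - p})
    v 0 (enum_rank ((i, m) : strand_index p)) *: 'X_[m].

Definition of_koszul p (a : 'rV[S]_(koszul_rank p)) : 'rV[R]_(strand_rank p) :=
  \row_k (a 0 (strand_val k).1)@_(strand_val k).2.

Lemma msize_to_koszul p v i : (msize (@to_koszul p v 0%R i) <= s.+1 - p)%N.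
Proof.
rewrite mxE; apply: leq_trans (msize_sum _ _ _) _; apply/bigmax_leqP => m _.
by rewrite (leq_trans (mmeasureZ_le _ _ _)) // msizeX; exact: bmdeg.
Qed.

Lemma mcoeff_to_koszul p v i (m : 'X_{1..3 < s.+1 - p}) :
  (@to_koszul p v 0 i)@_m = v 0 (enum_rank ((i, m) : strand_index p)).
Proof.
rewrite mxE raddf_sum (bigD1 m) //= mcoeffZ mcoeffX eqxx mulr1 big1 ?addr0 //.
move=> k km; rewrite mcoeffZ mcoeffX; case: (bmnm k =P m) => [kE|]; rewrite ?mulr0 //.
by case/eqP: km; exact: val_inj.
Qed.

Lemma of_koszulK p (a : 'rV[S]_(koszul_rank p)) :
  (forall i, (msize (a 0%R i) <= s.+1 - p)%N) -> to_koszul (of_koszul a) = a.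
Proof.
move=> a_size; apply/rowP => i; rewrite mxE [RHS](mpolywE (a_size i)).
by apply: eq_bigr => m _; rewrite mxE /strand_val enum_rankK.
Qed.

Lemma sum_strand p (V : nmodType) (F : 'I_(strand_rank p) -> V) :
  \sum_k F k = \sum_i \sum_m F (enum_rank ((i, m) : strand_index p)).
Proof.
rewrite pair_bigA /= (reindex (@enum_rank (strand_index p))) /=; last first.
  exact/onW_bij/enum_rank_bij.
by apply: eq_bigr => -[].
Qed.

Lemma to_koszul_inj p : injective (@to_koszul p).
Proof.
move=> v w vw; apply/rowP => k; rewrite -(enum_valK k).
by case: (enum_val k) => i m; rewrite -!mcoeff_to_koszul vw.
Qed.

Lemma msize_koszul_diff p (a : 'rV[S]_(koszul_rank p.+1)) j :
  (forall i, (msize (a 0%R i) <= s.+1 - p.+1)%N) ->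
  (msize ((a *m koszul_diff lin p) 0%R j) <= s.+1 - p)%N.
Proof.
move=> a_size; rewrite mxE; apply: leq_trans (msize_sum _ _ _) _.
apply/bigmax_leqP => i _; have [c [k ->]] := koszul_diff_entry lin i j.
have -> : a 0 i * (c%:~R * lin k) = (c%:~R)%:MP * (lin k * a 0 i).
  by rewrite rmorph_int; ring.
(* For [s < p] both truncated bounds are 0, so raising the degree by one is not allowed; there the
   entries of [a] vanish. *)
rewrite (leq_trans (msize_mulC_le _ _)) //; have [sp|ps] := ltnP s p.
  have /eqP : msize (a 0 i) = 0%N by have := a_size i; lia.
  by rewrite msize_poly_eq0 => /eqP ->; rewrite mulr0 msize0.
by rewrite (leq_trans (msize_linM T' dvK k (a_size i))) //; lia.
Qed.

Lemma to_koszul_diff p v :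
  to_koszul (v *m strand_diff p) = to_koszul v *m koszul_diff lin p.
Proof.
rewrite -[RHS]of_koszulK => [|j]; last first.
  by apply: msize_koszul_diff => i; exact: msize_to_koszul.
congr to_koszul; apply/rowP => l; rewrite !mxE sum_strand raddf_sum.
apply: eq_bigr => i _; rewrite [to_koszul _ _ _]mxE mulr_suml raddf_sum /=.
apply: eq_bigr => m _; rewrite [strand_diff _ _ _]mxE /strand_val enum_rankK.
by rewrite /= -scalerAl mcoeffZ (mulrC 'X_[m]).
Qed.

Lemma strand_exact p (v : 'rV_(strand_rank p.+1)) :
  v *m strand_diff p = 0 <-> exists w, v = w *m strand_diff p.+1.
Proof.
have to_koszul0 q : to_koszul (0 : 'rV_(strand_rank q)) = 0.
  by apply/rowP => i; rewrite !mxE big1 // => m _; rewrite mxE scale0r.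
split=> [v0|[w ->]]; last first.
  apply: to_koszul_inj; rewrite !to_koszul_diff -mulmxA koszul_diff_diff.
  by rewrite mulmx0 to_koszul0.
have [|b b_size bE] := koszul_exact (p := p) (fun i => msize_to_koszul v i).
  by rewrite -to_koszul_diff v0 to_koszul0.
exists (of_koszul b); apply: to_koszul_inj; rewrite to_koszul_diff of_koszulK //.
by move=> i; rewrite (leq_trans (b_size i)) //; lia.
Qed.

Lemma strand_augE (v : 'rV_(strand_rank 0)) :
  (v *m strand_aug) 0 0 = weight_eval T T' s (to_koszul v 0 0).
Proof.
rewrite mxE sum_strand big_ord1; apply: eq_bigr => m _.
rewrite mxE /strand_val enum_rankK; congr (_ * _).
by rewrite -(@mcoeff_to_koszul 0 v ord0 m) !ord1.
Qed.

Lemma strand_aug_exact (v : 'rV_(strand_rank 0)) : T' != 0 ->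
  (v *m strand_aug) 0 0 = 0 <-> exists w, v = w *m strand_diff 0.
Proof.
move=> T'0; rewrite strand_augE; split=> [v0|[w ->]].
  have [|b b_size bE] := weight_eval_exact T'0 _ v0; first exact: msize_to_koszul.
  exists (of_koszul b); apply: to_koszul_inj; rewrite to_koszul_diff of_koszulK //.
    by apply/rowP => i; rewrite [i]ord1.
  by move=> i; rewrite subSS subn0.
rewrite to_koszul_diff mxE raddf_sum big1 // => i _.
have -> : koszul_diff lin 0 i 0 = lin i.
  by rewrite mxE; case: i => [[|[|[|//]]] ilt] /=; congr lin; exact: val_inj.
rewrite mulrC /= weight_eval_lin // (leq_trans (msize_to_koszul _ _)) //.
by rewrite subSS subn0.
Qed.

End Strand.

End KoszulExact.

(** Exponent vectors correspond to tuples over ['I_k.+1] with sum at most [k]; [inord] loses nothing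
    as each exponent is at most [k]. *)
Lemma card_bmultinom n k : #|{: 'X_{1..n < k.+1}}| = 'C(n + k, n).
Proof.
rewrite -card_partial_ord_partitions -cardsT.
pose f (m : 'X_{1..n < k.+1}) : n.-tuple 'I_k.+1 := [tuple inord (m i) | i < n].
have m_lt (m : 'X_{1..n < k.+1}) i : (m i < k.+1)%N.
  by apply: leq_ltn_trans (bmdeg m); rewrite mdegE (bigD1 i) //= leq_addr.
have fE m i : tnth (f m) i = m i :> nat by rewrite tnth_mktuple inordK.
rewrite -(card_imset (f := f)) => [|m m' ff]; last first.
  by apply/val_inj/mnmP => i; rewrite -!fE ff.
apply: eq_card => t; rewrite !inE; apply/imsetP/idP => [[m _ ->]|tk].
  rewrite big_tuple -ltnS (eq_bigr (fun i => m i : nat)); last by move=> i _; exact: fE.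
  by rewrite -mdegE bmdeg.
have mt : (mdeg [multinom (tnth t i : nat) | i < n] < k.+1)%N.
  rewrite mdegE ltnS (eq_bigr (fun i => tnth t i : nat)) => [|i _]; last exact: mnmE.
  by rewrite big_tuple in tk.
exists (BMultinom mt) => //; apply: eq_from_tnth => i; apply: val_inj.
by rewrite /= fE /= mnmE.
Qed.

(** * From a resolution of an ideal [I] to one of [R / I] *)

Section Augment.
Variables (K : fieldType) (n : nat) (G : graded_free_complex K n).

Definition augment_rk i := if i is j.+1 then rk G j else 1%N.

Definition augment_gdeg i : 'I_(augment_rk i) -> int :=
  match i with 0%N => fun=> 0 | j.+1 => @gdeg _ _ G j end.

Definition augment_diff i : 'M[{mpoly K[n]}]_(augment_rk i.+1, augment_rk i) :=
  match i with 0%N => aug G | j.+1 => diff G j end.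

Fact augment_diff_homog i k l :
  homog_of_degree (@augment_gdeg i.+1 k - @augment_gdeg i l) (augment_diff i k l).
Proof.
case: i k l => [|i] k l; [rewrite subr0; exact: aug_homog|exact: diff_homog].
Qed.

Fact augment_aug_homog (k : 'I_(augment_rk 0)) l :
  homog_of_degree (augment_gdeg k) ((1%:M : 'M[{mpoly K[n]}]_1) k l).
Proof. by rewrite !ord1 mxE; exact: dhomog1. Qed.

Definition augment : graded_free_complex K n :=
  GradedFreeComplex augment_diff_homog augment_aug_homog.

(** The augmentation of [G] becomes the first differential; its image [I] is the kernel of
    [R -> R / I], and exactness elsewhere is shifted by one. *)
Lemma augment_resolution I : is_ideal I -> is_resolution G I (@ideal0 _) ->
  is_resolution augment (@ideal1 _) I.
Proof.
move=> Iid [Iaug Isurj G0 GS]; split=> //.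
- by move=> a _; exists a%:M; rewrite mulmx1 mxE subrr; case: Iid.
- move=> v; rewrite mulmx1; split=> [/Isurj [w]|[w ->]].
    rewrite /ideal0 => /eqP; rewrite subr_eq0 => /eqP vw.
    by exists w; apply/rowP => i; rewrite [i]ord1.
  by rewrite mxE; apply: is_ideal_sum => // k _; have [_ _] := Iid; apply.
- case=> [|i] v; last exact: GS.
  rewrite -G0 /ideal0; split=> [->|v0]; first by rewrite mxE.
  by apply/rowP => i; rewrite [i]ord1 v0 mxE.
Qed.

Lemma augment_minimal : is_minimal G -> (forall k, (aug G k 0)@_0%MM = 0) ->
  is_minimal augment.
Proof.
move=> minG aug0 [|i]; last exact: minG.
by apply/matrixP => k l; rewrite !mxE [l]ord1 aug0.
Qed.
End Augment.

(** * The strand as a minimal graded complex over [K[x]] *)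

Section StrandComplex.
Variables (K : fieldType) (n s : nat) (t : 'I_3 -> 'X_{1..n}) (t' : 'X_{1..n}).
Hypotheses (t_gt0 : forall i, (0 < mdeg (t i))%N) (t'_gt0 : (0 < mdeg t')%N).
Hypotheses
  (t_disj : forall i j k, i != j -> t i k = 0%N \/ t j k = 0%N)
  (t'_disj : forall i k, t i k = 0%N \/ t' k = 0%N).
Local Notation R := {mpoly K[n]}.
Local Notation T := (fun i => 'X_[t i] : R).
Local Notation T' := ('X_[t'] : R).

(* Kills the monomials that are not divisible by ['X_[t i]]. *)
Definition monomial_quo (i : 'I_3) : {additive R -> R} := mquo (@idfun K) (t i).

Lemma monomial_quoK i a : monomial_quo i ('X_[t i] * a) = a.
Proof. exact: mquoXM. Qed.

Lemma monomial_quoM i j a : i != j ->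
  monomial_quo i ('X_[t j] * a) = 'X_[t j] * monomial_quo i a.
Proof. by move=> ij; apply: mquoXM_coprime => k; apply: t_disj; rewrite eq_sym. Qed.

Lemma monomial_quoM' i a : monomial_quo i ('X_[t'] * a) = 'X_[t'] * monomial_quo i a.
Proof. by apply: mquoXM_coprime => k; case: (t'_disj i k); [right|left]. Qed.

Lemma monomial_quoC i j a :
  monomial_quo i (monomial_quo j a) = monomial_quo j (monomial_quo i a).
Proof. exact: mquoC. Qed.

(** Let [D] be the sum of the degrees of the four [T_i]. Then [w_i] has degree [D - deg T_i], and
    each Koszul generator has the degree [D] of [T_i w_i]. The formula is the degree of a product of
    [p] Koszul generators with [w^m] and [w_4 ^ (s - p - mdeg m)]. *)
Definition strand_gdeg p (k : 'I_(strand_rank s p)) : int :=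
  let m := (strand_val k).2 in
  s%:Z * ((\sum_i mdeg (t i))%N%:Z + (mdeg t')%:Z)
  - (\sum_i m i * mdeg (t i))%N%:Z - (s%:Z - p%:Z - (mdeg m)%:Z) * (mdeg t')%:Z.

Lemma strand_diff_entry p k l : exists (c : int) (i : 'I_3),
  strand_diff T T' s p k l =
  c%:~R * ((U_(i) + (strand_val k).2 == (strand_val l).2 :> 'X_{1..3})%MM%:R * 'X_[t i]
           - ((strand_val k).2 == (strand_val l).2 :> 'X_{1..3})%:R * 'X_[t']).
Proof.
have [c [i e]] := koszul_diff_entry (lin T T') (strand_val k).1 (strand_val l).1.
exists c, i; rewrite mxE e -mulrA -(rmorph_int (mpolyC 3 (R := R))) mcoeffCM.
rewrite mulrBl -mulrA -mpolyXD mcoeffB !mcoeffCM !mcoeffX.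
by rewrite ![_ * (_ == _)%:R]mulrC.
Qed.

Lemma strand_weightE (m : 'X_{1..3}) :
  weight T T' s m = 'X_[\sum_i t i *+ (s - m i) + t' *+ mdeg m].
Proof. by rewrite /weight mpolyXD mpolyXn -mprodXnE. Qed.

Lemma homog_of_degreeX (d : int) (m : 'X_{1..n}) :
  (mdeg m)%:Z = d -> homog_of_degree d ('X_[m] : R).
Proof.
move=> md; apply/homog_of_degreeP => k; rewrite mcoeffX.
by case: (m =P k) => [<-|]; rewrite ?eqxx.
Qed.

Lemma homog_of_degree_int (c : int) : homog_of_degree 0 (c%:~R : R).
Proof.
apply/homog_of_degreeP => m; rewrite -(rmorph_int (mpolyC n (R := K))) mcoeffC.
by case: (m =P 0%MM) => [->|]; rewrite ?mulr0 ?eqxx ?mdeg0.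
Qed.

Lemma homog_of_degreeM (d e : int) (p q : R) :
  homog_of_degree d p -> homog_of_degree e q -> homog_of_degree (d + e) (p * q).
Proof.
move=> hp hq; rewrite -(homog_part_id hp) -(homog_partM _ _ hq).
exact: homog_part_homog.
Qed.

Lemma homog_of_degreeB (d : int) (p q : R) :
  homog_of_degree d p -> homog_of_degree d q -> homog_of_degree d (p - q).
Proof.
move=> /homog_of_degreeP hp /homog_of_degreeP hq; apply/homog_of_degreeP => m.
rewrite mcoeffB; have [p0|/hp //] := eqVneq p@_m 0.
by rewrite p0 add0r oppr_eq0 => /hq.
Qed.

Lemma homog_of_degree_bool (d : int) (b : bool) (p : R) :
  (b -> homog_of_degree d p) -> homog_of_degree d (b%:R * p).
Proof.
case: b => [hp|_]; first by rewrite mul1r; exact: hp.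
by rewrite mul0r; apply/homog_of_degreeP => m; rewrite mcoeff0 eqxx.
Qed.

Fact strand_diff_homog p k l :
  homog_of_degree (@strand_gdeg p.+1 k - @strand_gdeg p l) (strand_diff T T' s p k l).
Proof.
have [c [i ->]] := strand_diff_entry k l; rewrite -[X in homog_of_degree X _]add0r.
apply: homog_of_degreeM; first exact: homog_of_degree_int.
rewrite /strand_gdeg; move: (bmnm (strand_val k).2) (bmnm (strand_val l).2) => mk ml.
apply: homog_of_degreeB; apply: homog_of_degree_bool => /eqP <-;
  apply: homog_of_degreeX; rewrite -(addn1 p); last by rewrite !PoszD; ring.
have -> : (\sum_j (U_(i) + mk)%MM j * mdeg (t j) =
           mdeg (t i) + \sum_j mk j * mdeg (t j))%N.
  rewrite (bigD1 i) //= [in RHS](bigD1 i) //= mnmDE mnm1E eqxx mulnDl mul1n addnA.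
  by congr (_ + _)%N; apply: eq_bigr => j; rewrite mnmDE mnm1E eq_sym => /negbTE ->.
by rewrite mdegD mdeg1 !PoszD; ring.
Qed.

Fact strand_aug_homog k l :
  homog_of_degree (@strand_gdeg 0 k) (strand_aug T T' s k l).
Proof.
rewrite mxE strand_weightE; apply: homog_of_degreeX.
rewrite /strand_gdeg; move: (strand_val k).2 => m /=.
rewrite mdegD mdegMn mdeg_sum (eq_bigr _ (fun i _ => mdegMn _ _)).
have m_le i : (m i <= s)%N.
  by rewrite -ltnS (leq_ltn_trans _ (bmdeg m)) // mdegE (bigD1 i) //= leq_addr.
have : (\sum_i mdeg (t i) * (s - m i) + \sum_i m i * mdeg (t i) =
  s * \sum_i mdeg (t i))%N.
  rewrite -big_split big_distrr /=; apply: eq_bigr => i _.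
  by rewrite [(m i * _)%N]mulnC -mulnDr subnK // mulnC.
set x := (\sum_i mdeg (t i) * (s - m i))%N; set y := (\sum_i m i * _)%N.
set z := (\sum_i mdeg (t i))%N => xyz.
have zE : s%:Z * z%:Z = x%:Z + y%:Z by rewrite -PoszM -xyz PoszD.
by rewrite PoszD PoszM mulrDr zE; ring.
Qed.

Definition strand_complex : graded_free_complex K n :=
  GradedFreeComplex strand_diff_homog strand_aug_homog.

Definition strand_ideal (a : R) : Prop :=
  exists v : 'rV_(strand_rank s 0), a = (v *m strand_aug T T' s) 0 0.

Lemma strand_complex_resolution (I : R -> Prop) :
  (forall a, I a <-> strand_ideal a) -> is_resolution strand_complex I (@ideal0 _).
Proof.
move=> IE; split=> [k|a /IE [v ->]|v|p v] /=.
- by apply/IE; exists (delta_mx 0 k); rewrite -rowE !mxE.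
- by exists v; rewrite /ideal0 subrr.
- apply: (strand_aug_exact monomial_quoK monomial_quoM monomial_quoM' monomial_quoC v).
  by apply/eqP => /(congr1 (mcoeff t')); rewrite mcoeffX eqxx mcoeff0 => /eqP;
     rewrite oner_eq0.
- exact: (strand_exact monomial_quoK monomial_quoM monomial_quoM' v).
Qed.

Lemma strand_complex_minimal : is_minimal strand_complex.
Proof.
have X0 (m : 'X_{1..n}) : (0 < mdeg m)%N -> ('X_[m] : R)@_0%MM = 0.
  by rewrite mcoeffX lt0n mdeg_eq0 => /negbTE ->.
move=> p; apply/matrixP => k l; rewrite [RHS]mxE [LHS]mxE /=.
have [c [i ->]] := strand_diff_entry k l.
by rewrite rmorphM rmorphB !rmorphM /= !X0 // !mulr0 subrr mulr0.
Qed.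

Lemma strand_aug_minimal k : (0 < s)%N -> (strand_aug T T' s k 0)@_0%MM = 0.
Proof.
move=> s_gt0; rewrite mxE strand_weightE mcoeffX -mdeg_eq0 mdegD mdegMn addn_eq0.
move: (bmnm (strand_val k).2) => m; rewrite muln_eq0 (gtn_eqF t'_gt0) /=.
(* A weight is not constant: for [m] nonzero it contains [T'], and for [m = 0] it contains the
   [s]-th power of the first [T]. *)
have [/eqP|m_gt0] := posnP (mdeg m); last by rewrite andbF.
rewrite mdeg_eq0 => /eqP ->; rewrite mdeg_sum (bigD1 ord0) //= mdegMn mnm0E subn0.
by rewrite addn_eq0 muln_eq0 (gtn_eqF s_gt0) (gtn_eqF (t_gt0 _)).
Qed.

Lemma strand_idealX (m : 'X_{1..3}) : (mdeg m <= s)%N ->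
  strand_ideal (weight T T' s m).
Proof.
move=> ms; pose k : strand_index s 0 := (ord0, BMultinom (ms : mdeg m < s.+1)%N).
by exists (delta_mx 0 (enum_rank k)); rewrite -rowE !mxE /strand_val enum_rankK.
Qed.

Lemma strand_ideal_ideal : is_ideal strand_ideal.
Proof.
split=> [|_ _ [v ->] [w ->]|c _ [v ->]].
- by exists 0; rewrite mul0mx mxE.
- by exists (v - w); rewrite mulmxBl [RHS]mxE [X in _ = _ + X]mxE.
- by exists (c *: v); rewrite -scalemxAl [RHS]mxE.
Qed.

Lemma strand_ideal_ind (P : R -> Prop) : is_ideal P ->
  (forall m, (mdeg m <= s)%N -> P (weight T T' s m)) ->
  forall a, strand_ideal a -> P a.
Proof.
move=> Pid Pw _ [v ->]; rewrite mxE; apply: is_ideal_sum => // k _.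
by have [_ _] := Pid; apply; rewrite mxE; apply: Pw; rewrite -ltnS; exact: bmdeg.
Qed.

End StrandComplex.

(** The Koszul ranks 1, 3, 3, 1 are multiplied by the number of monomials of degree at most [s - p]
    in three variables. For [p > s] the index set is empty and the expected rank is 0. *)
Lemma card_strand s p : (0 < s)%N -> strand_rank s p = cover4_rank s p.+1.
Proof.
move=> s_gt0; rewrite /strand_rank card_prod card_ord.
have [sp|ps] := ltnP s p.
  have -> : (s.+1 - p = 0)%N by lia.
  rewrite [X in (_ * X)%N](_ : _ = 0%N) ?muln0; last first.
    by apply: eq_card0 => -[m ?]; exfalso.
  by case: p sp => [|[|[|[|p]]]] //= sp; rewrite bin_small ?muln0 //; lia.
have -> : (s.+1 - p = (s - p).+1)%N by lia.
rewrite card_bmultinom; case: p ps => [|[|[|[|p]]]] ps /=.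
- by rewrite mul1n subn0 addnC.
- by congr (_ * 'C(_, _))%N; lia.
- by congr (_ * 'C(_, _))%N; lia.
- by rewrite mul1n; congr 'C(_, _); lia.
- by rewrite /koszul_rank /= nth_nil mul0n.
Qed.

(** * Powers of the cover ideal *)

Section WeightStep.
Variables (n : nat) (R : idomainType) (T : 'I_n -> R) (T' : R).

(** The product of the [T i] is the image of [w_4], which leaves the exponents of [w_1, w_2, w_3]
    unchanged; [weightSU] is multiplication by the other [w_i]. *)
Lemma weightS s (m : 'X_{1..n}) : (mdeg m <= s)%N ->
  weight T T' s.+1 m = weight T T' s m * \prod_i T i.
Proof.
move=> ms; rewrite /weight [RHS]mulrAC -big_split /=; congr (_ * _).
apply: eq_bigr => i _; rewrite subSn ?exprSr // (leq_trans _ ms) //.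
by rewrite mdegE (bigD1 i) //= leq_addr.
Qed.

Lemma weightSU s (m : 'X_{1..n}) i : (mdeg m <= s)%N ->
  weight T T' s.+1 (U_(i) + m) =
  weight T T' s m * (T' * \prod_(j | j != i) T j).
Proof.
move=> ms; rewrite /weight mdegD mdeg1 exprS !(bigD1 (P := xpredT) i) //=.
rewrite mnmDE mnm1E eqxx subSS.
rewrite (eq_bigr (fun j => T j ^+ (s - m j) * T j)) => [|j ji]; last first.
  rewrite mnmDE mnm1E eq_sym (negbTE ji) add0n subSn ?exprSr // (leq_trans _ ms) //.
  by rewrite mdegE (bigD1 j) //= leq_addr.
by rewrite big_split /=; ring.
Qed.
End WeightStep.

Section CoverIdeal.
Variables (K : fieldType) (m : 'I_4 -> nat).
Local Notation V := (multipartite_vertex m).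
Local Notation R := {mpoly K[#|V|]}.
Local Notation J := (cover_ideal K (multipartite_edge (m := m))).

Definition part_mnm (j : 'I_4) : 'X_{1..#|V|} :=
  (\sum_(v : V | tag v == j) U_(enum_rank v))%MM.

Definition part_cover (j : 'I_4) : R := \prod_(v : V | tag v != j) 'X_(enum_rank v).

Lemma part_mnmE j k : part_mnm j k = (tag (enum_val k : V) == j).
Proof.
rewrite mnm_sumE big_mkcond (bigD1 (enum_val k)) //= mnm1E enum_valK eqxx.
rewrite big1 ?addn0 => [|v vk]; first by case: eqP.
by rewrite mnm1E -(inj_eq enum_val_inj) enum_rankK (negbTE vk) if_same.
Qed.

Lemma part_mnm_disj i j k : i != j -> part_mnm i k = 0%N \/ part_mnm j k = 0%N.
Proof.
rewrite !part_mnmE => ij; case: eqP => [->|_]; last by left.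
by right; rewrite (negbTE ij).
Qed.

Lemma mdeg_part_mnm j : mdeg (part_mnm j) = m j.
Proof.
rewrite mdeg_sum (eq_bigr (fun=> 1%N)) => [|v _]; last exact: mdeg1.
rewrite sum1_card -[RHS]card_ord.
rewrite -(card_image (f := fun i => Tagged (fun k => 'I_(m k)) i : V)); last first.
  by move=> i i' /eqP; rewrite eq_Tagged => /eqP.
apply: eq_card => v; apply/idP/imageP => [|[i _ ->]]; last exact: eqxx.
case: v => k i ki; have /eqP kj : k == j by exact: ki.
by move: i {ki}; rewrite kj => i; exists i.
Qed.

Lemma part_coverE j : part_cover j = \prod_(k | k != j) 'X_[part_mnm k].
Proof.
rewrite /part_cover (partition_big (fun v : V => tag v) (fun k => k != j)) //=.
apply: eq_bigr => k kj; rewrite mprodXE; congr 'X_[_]; apply: eq_bigl => v.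
by case: (tag v =P k) => [->|]; rewrite ?kj ?andbF.
Qed.

Lemma cover_ideal_part_cover j : J (part_cover j).
Proof.
apply: ideal_gen_mem; exists [set v : V | tag v != j]; split.
  apply/forallP => a; apply/forallP => b; apply/implyP; rewrite !inE /multipartite_edge.
  by case: (tag a =P j) => //= ->; rewrite eq_sym.
by apply: eq_bigl => v; rewrite inE.
Qed.

(** A vertex cover that misses [a] contains all neighbours of [a], that is, all vertices outside the
    part of [a]. So the complements of the parts generate [J]. *)
Lemma cover_ideal_ind (P : R -> Prop) : is_ideal P ->
  (forall j, P (part_cover j)) -> forall y, J y -> P y.
Proof.
move=> Pid Pcov; apply: ideal_gen_ind => // _ [w [w_cover ->]].
have [j wj] : exists j, forall v : V, tag v != j -> v \in w.
  have [/existsP[a aw]|/existsPn w_all] := boolP [exists a, a \notin w].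
    exists (tag a) => v va; have /forallP/(_ v)/forallP/(_ a) := w_cover.
    by rewrite /multipartite_edge va (negbTE aw) orbF.
  by exists ord0 => v _; have := w_all v; rewrite negbK.
rewrite (bigID (fun v : V => tag v != j)) /= mulrC.
rewrite [X in _ * X](eq_bigl (fun v : V => tag v != j)).
  by have [_ _] := Pid; apply; exact: Pcov.
by move=> v /=; case: (boolP (tag v != j)) => [/wj ->|]; rewrite ?andbF.
Qed.

Local Notation t := (fun i : 'I_3 => part_mnm (widen_ord (leqnSn 3) i)).
Local Notation t' := (part_mnm ord_max).
Local Notation X := (fun i : 'I_3 => 'X_[t i] : R).
Local Notation X' := ('X_[t'] : R).

Lemma part_cover_max : part_cover ord_max = \prod_i X i.
Proof.
rewrite part_coverE big_mkcond big_ord_recr eqxx /= mulr1.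
by apply: eq_bigr => i _; rewrite -val_eqE /= ltn_eqF.
Qed.

Lemma part_cover_widen i :
  part_cover (widen_ord (leqnSn 3) i) = X' * \prod_(k | k != i) X k.
Proof.
rewrite part_coverE big_mkcond big_ord_recr /= mulrC [in RHS]big_mkcond /=.
by rewrite -val_eqE /= gtn_eqF.
Qed.

Lemma part_ordP (j : 'I_4) : j = ord_max \/ exists i, j = widen_ord (leqnSn 3) i.
Proof.
case: (unliftP ord_max j) => [i ->|->]; [right|by left].
by exists i; apply: val_inj; rewrite [LHS]lift_max.
Qed.

Lemma strand_ideal_part_cover s k j : (mdeg k <= s)%N ->
  strand_ideal s.+1 t t' (weight X X' s k * part_cover j).
Proof.
move=> ks; case: (part_ordP j) => [->|[i ->]].
  by rewrite part_cover_max -weightS //; apply: strand_idealX; exact: leqW.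
rewrite part_cover_widen -weightSU //; apply: strand_idealX.
by rewrite mdegD mdeg1.
Qed.

(** By induction on [s]: through colon ideals the earlier product is reduced to a weight and the new
    factor to some [part_cover j]. *)
Lemma strand_ideal_prod s (f : 'I_s -> R) : (forall i, J (f i)) ->
  strand_ideal s t t' (\prod_i f i).
Proof.
elim: s f => [|s IHs] f Jf.
  rewrite big_ord0 (_ : 1 = weight X X' 0 0%MM); first by apply: strand_idealX; rewrite mdeg0.
  by rewrite /weight mdeg0 expr0 mulr1 big1.
rewrite big_ord_recr /=; move: (IHs _ (fun i => Jf (widen_ord (leqnSn s) i))).
move: (\prod_(i < s) _) => x; move: x.
apply: strand_ideal_ind => [|k ks]; first exact/is_ideal_quo/strand_ideal_ideal.
move: (f ord_max) (Jf ord_max) => y Jy; rewrite mulrC; move: y Jy.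
apply: cover_ideal_ind => [|j]; first exact/is_ideal_quo/strand_ideal_ideal.
by rewrite mulrC; exact: strand_ideal_part_cover.
Qed.

Lemma weight_prod s (k : 'X_{1..3}) : (mdeg k <= s)%N ->
  exists f : 'I_s -> R, (forall i, J (f i)) /\ weight X X' s k = \prod_i f i.
Proof.
elim: s k => [|s IHs] k ks.
  exists (fun=> 0); split=> [[]|] //; rewrite big_ord0 /weight.
  move: ks; rewrite leqn0 mdeg_eq0 => /eqP ->.
  by rewrite mdeg0 expr0 mulr1 big1.
(* For [k = 0] a factor [part_cover ord_max] is split off; otherwise the one for an [i] with [k i]
   nonzero. *)
have [/eqP|] := posnP (mdeg k).
  rewrite mdeg_eq0 => /eqP ->; rewrite weightS ?mdeg0 // -part_cover_max.
  apply: ideal_exp_prodS; last exact: cover_ideal_part_cover.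
  by apply: IHs; rewrite mdeg0.
rewrite lt0n mdegE sum_nat_eq0 => /forallPn[/= i ki].
have Uk : (U_(i) <= k)%MM by rewrite lep1mP.
move: ks; rewrite -(submK Uk) addmC mdegD mdeg1 => ks.
rewrite weightSU // -part_cover_widen.
by apply: ideal_exp_prodS; [exact: IHs|exact: cover_ideal_part_cover].
Qed.

Lemma ideal_exp_coverE s a : ideal_exp J s a <-> strand_ideal s t t' a.
Proof.
split; move: a.
  apply: ideal_gen_ind => [|_ [f [Jf ->]]]; first exact: strand_ideal_ideal.
  exact: strand_ideal_prod.
apply: strand_ideal_ind => [|k ks]; first exact: ideal_gen_ideal.
by apply: ideal_gen_mem; exact: weight_prod.
Qed.

End CoverIdeal.

(** * Generator degrees and the maximum in the regularity formula *)

Lemma is_max_ext (A B : int -> Prop) r :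
  (forall z, A z <-> B z) -> is_max A r -> is_max B r.
Proof. by move=> AB [/AB Br Ar]; split=> // z /AB /Ar. Qed.

Lemma is_max_fin (X : finType) (x0 : X) (f : X -> int) :
  exists r, is_max (fun z => exists x, z = f x) r.
Proof.
case: (arg_maxP (P := xpredT) f (erefl : xpredT x0)) => x _ x_max.
by exists (f x); split=> [|_ [y ->]]; [exists x|exact: x_max].
Qed.

Lemma strand_rank_lt4 s p (k : 'I_(strand_rank s p)) : (p < 4)%N.
Proof.
case: p k => [|[|[|[|p]]]] // k; suff : (k < 0)%N by [].
apply: leq_trans (ltn_ord k) _.
by rewrite /strand_rank card_prod card_ord /koszul_rank /= nth_nil.
Qed.

Section Candidates.
Variables (n s : nat) (t : 'I_3 -> 'X_{1..n}) (t' : 'X_{1..n}).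

Lemma strand_gdeg_set z :
  (exists p (k : 'I_(strand_rank s p)), z = strand_gdeg t t' k - p%:Z) <->
  (exists x : {p : 'I_4 & 'I_(strand_rank s p)},
    z = strand_gdeg t t' (tagged x) - (tag x)%:Z).
Proof.
split=> [[p [k ->]]|[[p k] ->]]; last by exists p, k.
have p4 := strand_rank_lt4 k.
by exists (Tagged (fun q : 'I_4 => 'I_(strand_rank s q)) (k : 'I_(strand_rank s (Ordinal p4)))).
Qed.

(** Take for [l4], [l3], [l2] the exponents of [w_1], [w_2], [w_3], and [l1 = s - mdeg m]. In
    homological degree [p] the bound [mdeg m <= s - p] becomes [p <= l1], which implies the upper
    bounds on the other [l]; the four cases are [p = 0, 1, 2, 3]. *)
Lemma strand_gdeg_candidate z :
  (exists p (k : 'I_(strand_rank s p)), z = strand_gdeg t t' k - p%:Z) <->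
  cover4_reg_candidate s (mdeg (t ord0)) (mdeg (t (lift ord0 ord0)))
    (mdeg (t (lift ord0 (lift ord0 ord0)))) (mdeg t') z.
Proof.
set d1 := mdeg (t ord0); set d2 := mdeg (t _); set d3 := mdeg (t _).
set d4 := mdeg t'.
pose deg (p a b c : nat) : int :=
  s%:Z * (d1%:Z + d2%:Z + d3%:Z + d4%:Z)
  - (a%:Z * d1%:Z + b%:Z * d2%:Z + c%:Z * d3%:Z)
  - (s%:Z - p%:Z - (a%:Z + b%:Z + c%:Z)) * d4%:Z.
have mdeg3 (k : 'X_{1..3}) :
    mdeg k = (k ord0 + k (lift ord0 ord0)%R + k (lift ord0 (lift ord0 ord0)))%N.
  by rewrite mdegE !big_ord_recl big_ord0 addn0 addnA.
have gdegE p (k : 'I_(strand_rank s p)) : let x := (strand_val k).2 in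
    strand_gdeg t t' k = deg p (x ord0) (x (lift ord0 ord0)) (x (lift ord0 (lift ord0 ord0))).
  rewrite /= /strand_gdeg mdeg3 !big_ord_recl !big_ord0 /= -/d1 -/d2 -/d3 -/d4 /deg.
  by rewrite !addn0 !PoszD !PoszM; ring.
have gdeg_surj p (a b c : nat) : (p < 4)%N -> (a + b + c < s.+1 - p)%N ->
    exists k : 'I_(strand_rank s p), strand_gdeg t t' k = deg p a b c.
  move=> p4 abc; pose x := [multinom nth 0%N [:: a; b; c] i | i < 3].
  have xs : (mdeg x < s.+1 - p)%N by rewrite mdeg3 !mnmE.
  have p_gt0 : (0 < koszul_rank p)%N by case: p p4 {abc xs} => [|[|[|[|]]]].
  exists (enum_rank ((Ordinal p_gt0, BMultinom xs) : strand_index s p)).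
  by rewrite gdegE /strand_val enum_rankK /= !mnmE.
split.
  case=> p [k ->]; have p4 := strand_rank_lt4 k.
  rewrite gdegE; have := bmdeg (strand_val k).2; rewrite mdeg3.
  move: (_ ord0) (_ (lift ord0 ord0)) (_ (lift ord0 (lift ord0 ord0))) => a b c abc.
  exists (s%:Z - (a%:Z + b%:Z + c%:Z)), c%:Z, b%:Z, a%:Z; split; first by ring.
  rewrite /deg; case: p p4 {k} abc => [|[|[|[|//]]]] _ abc.
  - by apply: Or41; split; [split; lia|ring].
  - by apply: Or42; split; [split; lia|ring].
  - by apply: Or43; split; [split; lia|ring].
  - by apply: Or44; split; [split; lia|ring].
have cand (p : nat) (l1 l2 l3 l4 : int) : (p < 4)%N -> l1 + l2 + l3 + l4 = s ->
    [/\ p%:Z <= l1, 0 <= l2, 0 <= l3 & 0 <= l4] ->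
    exists q (k : 'I_(strand_rank s q)),
      (s%:Z - l4) * d1 + (s%:Z - l3) * d2 + (s%:Z - l2) * d3 + (s%:Z - l1) * d4 +
      p%:Z * d4%:Z - p%:Z = strand_gdeg t t' k - q%:Z.
  move=> p4 l_sum [l1p l2p l3p l4p]; exists p.
  have [|k kE] := gdeg_surj p `|l4|%N `|l3|%N `|l2|%N p4; first by lia.
  exists k; rewrite kE /deg !gez0_abs //; have -> : l1 = s%:Z - (l2 + l3 + l4) by lia.
  by ring.
move=> [l1 [l2 [l3 [l4 [l_sum /= cases]]]]].
have [p [p4 [l_ge z_eq]]] : exists p : nat, (p < 4)%N /\
    [/\ p%:Z <= l1, 0 <= l2, 0 <= l3 & 0 <= l4] /\
    z = (s%:Z - l4) * d1 + (s%:Z - l3) * d2 + (s%:Z - l2) * d3 + (s%:Z - l1) * d4 +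
        p%:Z * d4%:Z - p%:Z.
  case: cases => -[[]] /andP[? _] /andP[? _] /andP[? _] /andP[? _] ->.
  - by exists 0%N; split=> //; split=> //; ring.
  - by exists 1%N; split=> //; split=> //; ring.
  - by exists 2%N; split=> //; split=> //; ring.
  - by exists 3%N; split=> //; split=> //; ring.
by rewrite z_eq; exact: cand l_ge.
Qed.
End Candidates.

Theorem theorem4p8 (K : fieldType) (m1 m2 m3 m4 s : nat)
    (hm1 : (1 <= m1)%N) (hm2 : (1 <= m2)%N) (hm3 : (1 <= m3)%N)
    (hm4 : (1 <= m4)%N) (hs : (1 <= s)%N) :
  let J := cover_ideal K (multipartite_edge (m := part_size4 m1 m2 m3 m4)) in
  let Js := ideal_exp J s in
  [/\ exists F, is_minimal_resolution F (@ideal1 _) Js,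
      forall F, is_minimal_resolution F (@ideal1 _) Js ->
        forall i, rk F i = cover4_rank s i
    & exists r : int, is_reg Js (@ideal0 _) r /\
        is_max (cover4_reg_candidate s m1 m2 m3 m4) r].
Proof.
set m := part_size4 m1 m2 m3 m4; move=> J Js.
pose t (i : 'I_3) := part_mnm m (widen_ord (leqnSn 3) i).
pose t' := part_mnm m ord_max.
have t_gt0 i : (0 < mdeg (t i))%N.
  by rewrite mdeg_part_mnm; case: i => [[|[|[|//]]]].
have t'_gt0 : (0 < mdeg t')%N by rewrite mdeg_part_mnm.
have t_disj i j k : i != j -> t i k = 0%N \/ t j k = 0%N.
  by move=> ij; apply: part_mnm_disj.
have t'_disj i k : t i k = 0%N \/ t' k = 0%N.
  by apply: part_mnm_disj; rewrite -val_eqE /= ltn_eqF.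
pose G := strand_complex K s t t'.
have resG : is_resolution G Js (@ideal0 _).
  by apply: strand_complex_resolution => // a; exact: ideal_exp_coverE.
have minG : is_minimal G by exact: strand_complex_minimal.
have Jid : is_ideal Js by exact: ideal_gen_ideal.
have minF : is_minimal_resolution (augment G) (@ideal1 _) Js.
  split; first exact: augment_resolution.
  by apply: augment_minimal => // k; exact: strand_aug_minimal.
split; first by exists (augment G).
  move=> F resF i; rewrite (minimal_resolution_rk i Jid resF minF).
  by case: i => //= i; rewrite card_strand.
(* Any resolution compares with [G], so its homology lives in degrees of generators of [G];
   conversely each generator of the minimal [G] gives a nonzero class. *)
have TorE i j : Tor_neq0 Js (@ideal0 _) i j <-> exists l : 'I_(rk G i), gdeg l = j.
  split=> [[F [resF Fij]]|[l <-]]; first exact: homologyK_gdeg resF resG Fij.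
  by exists G; split=> //; exact: minimal_homologyK_gdeg.
(* The monomial 1 in homological degree 0 shows that the finite set of degrees is nonempty, so a
   maximum exists. *)
have k0 : 'I_(strand_rank s 0).
  by apply: (@enum_rank (strand_index s 0) (ord0, bm0)).
have [r r_max] := is_max_fin
  (Tagged (fun q : 'I_4 => 'I_(strand_rank s q)) (k0 : 'I_(strand_rank s (ord0 : 'I_4))))
  (fun x => strand_gdeg t t' (tagged x) - (tag x)%:Z).
(* Both sets consist of the numbers [gdeg - p] over the generators of [G], so they share the maximum
   [r]. *)
exists r; split; move: r_max; apply: is_max_ext => z; rewrite -strand_gdeg_set.
  split=> [[p [k ->]]|[p [j [/TorE [k <-] ->]]]]; last by exists p, k.
  by exists p, (strand_gdeg t t' k); split=> //; apply/TorE; exists k.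
by rewrite strand_gdeg_candidate !mdeg_part_mnm.
Qed.
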